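(* Let $q$ be a power of an odd prime with $q\equiv 1 \pmod 4$, let $m\geq 2$, and let $V$ be a $2m$-dimensional vector space over $\mathbb{F}_q$ equipped with a non-degenerate alternating bilinear form $f$, with isometry group $\mathrm{Sp}(V)\cong\mathrm{Sp}(2m,q)$. Let $G$ be a solvable subgroup of $\mathrm{Sp}(V)$. Then $G$ does not act transitively on any complete symplectic spread of $V$ (with respect to $f$).
   Context: A subspace $W$ of $V$ is totally isotropic with respect to $f$ if $f(w,w')=0$ for all $w,w'\in W$. A complete symplectic spread of $V$ is a collection of $q^m+1$ totally isotropic $m$-dimensional subspaces of $V$ whose union is $V$ and which intersect pairwise trivially. Elements of $\mathrm{Sp}(V)$ permute the totally isotropic $m$-dimensional subspaces; $G$ acts on a spread $\Omega$ if it permutes its members. *)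

(* Defs.v *)
From HB Require Import structures.
From mathcomp Require Import all_boot all_order all_algebra.
From mathcomp Require Import all_fingroup all_solvable all_field.

Set Implicit Arguments.
Unset Strict Implicit.
Unset Printing Implicit Defensive.

Import GRing.Theory.
Local Open Scope ring_scope.

Section Symplectic.
Variables (F : finFieldType) (V : vectType F).

(* A vectType has no canonical finType structure; finvect_type V is V itself,
   equipped with one (as F is finite), so that permutations of V and sets of
   vectors are available. *)
Local Notation fV := (finvect_type V).

(* An alternating form is skew-symmetric in every characteristic, so taking
   {skew_symmetric V} as the type of f is no restriction on the bilinear form:
   it gives access to the library's nondegenerate. The converse implication
   fails in characteristic 2, hence this separate predicate. *)
Definition alternating (f : {skew_symmetric V}) := forall v : V, f v v = 0.

Variable f : {skew_symmetric V}.

Definition Sp : {set {perm fV}} :=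
  [set s : {perm fV} |
     [forall a : F, forall u : fV, forall v : fV,
        s (a *: u + v) == a *: s u + s v]
   & [forall u : fV, forall v : fV, f (s u) (s v) == f u v]].

Lemma SpP (s : {perm fV}) :
  reflect (linear (s : fV -> fV) /\ isometry f f (s : V -> V)) (s \in Sp).
Proof.
rewrite inE; apply: (iffP andP) => -[slin siso]; split.
- by move=> a u v; apply/eqP; move/forallP/(_ a)/forallP/(_ u)/forallP: slin.
- by move=> u v; apply/eqP; move/forallP/(_ u)/forallP: siso.
- by do 3!apply/forallP=> ?; rewrite slin.
- by do 2!apply/forallP=> ?; rewrite siso.
Qed.

Lemma Sp_group_set : group_set Sp.
Proof.
apply/group_setP; split=> [|s t /SpP[slin siso] /SpP[tlin tiso]].
  by apply/SpP; split=> [a u v|u v]; rewrite !perm1.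
apply/SpP; split=> [a u v|u v]; first by rewrite !permM slin tlin.
by rewrite !permM tiso siso.
Qed.

Canonical Sp_group := Group Sp_group_set.

Definition totally_isotropic (W : {vspace V}) :=
  {in W &, forall w w' : V, f w w' = 0}.

(* Subspaces occur as members of Omega through their sets of vectors, on which
   {perm fV} acts by 'P^* (images of sets). *)
Definition complete_symplectic_spread (m : nat) (Omega : {set {set fV}}) :=
  [/\ #|Omega| = (#|F| ^ m + 1)%N,
      {in Omega, forall A, exists W : {vspace V},
         [/\ A = [set v : fV | (v : V) \in W], \dim W = m
           & totally_isotropic W]},
      cover Omega = [set: fV]
    & {in Omega &, forall A B : {set fV}, A != B -> A :&: B = [set 0]}].

End Symplectic.

(* Main.v *)
Require Import Defs.
From HB Require Import structures.
From mathcomp Require Import all_boot all_order all_algebra.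
From mathcomp Require Import all_fingroup all_solvable all_field.
From mathcomp Require Import mxrepresentation mxabelem zify.

(** Write q = #|F| and dim V = 2m.  A primitive prime divisor p of q^2m - 1
divides q^m + 1 = #|Omega|, so a transitive G contains an element g of order
p; it acts irreducibly on V and p > 2m.  Let N be a minimal normal subgroup of
G not centralised by g.  The centraliser of g is cyclic, which forces N to have
class 2 with g acting trivially on Z(N) and without fixed points on the chief
factor N/Z(N).  Coset representatives of Z(N) in N are linearly independent
over F[Z(N)], so #|N : Z(N)| = s^2 with s <= 2m, and p divides
(s - 1)(s + 1); hence either <[g]> is normal in G, or s = 2m = p - 1, N/Z(N) is
a 2-group and N spans End(V).

In the second case every x in N has x^2 = 1 or -1, so it is diagonalisable
over F (as -1 is a square) and fixes few members of Omega; but the N-orbits on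
Omega have size at most 2, since #|Omega| = 2 mod 4, and counting fixed pairs
gives a contradiction.

In the first case G is semilinear over F[g].  The 2-elements centralising g are
1 and -1, so a Sylow 2-subgroup S is abelian and contains some j inverting g
with j^2 = 1 or -1.  As j fixes at most 2m members of Omega, an eigenspace of j
of dimension at least m lies in one member, which S then fixes; this is absurd
since #|Omega| is even. *)

Set Implicit Arguments.
Unset Strict Implicit.
Unset Printing Implicit Defensive.
Import Order.TTheory GroupScope GRing.Theory Num.Theory VectorInternalTheory.
Local Open Scope ring_scope.

(** * Primitive prime divisors *)

(** Over [algC] the value is the product of [q - zeta] over the primitive [n]-th roots of unity
    [zeta], and each factor has norm at least [q - 1]. *)
Lemma Cyclotomic_lower_bound (q n : nat) : (0 < q)%N -> (0 < n)%N ->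
  (q.-1 ^ totient n <= `|('Phi_n).[q%:Z]|)%N.
Proof.
move=> q_gt0 n_gt0; have [z prim_z] := C_prim_root_exists n_gt0.
have evalE : (('Phi_n).[q%:Z])%:~R = \prod_(k < n | coprime k n) (q%:R - z ^+ k) :> algC.
  rewrite -horner_map /= (Cintr_Cyclotomic prim_z) /cyclotomic horner_prod.
  by apply: eq_bigr => k _; rewrite hornerXsubC.
rewrite -(ler_nat algC) natrX natr_absz intr_norm evalE normr_prod.
have -> : totient n = #|[pred k : 'I_n | coprime k n]|.
  rewrite totient_count_coprime -big_mkcond big_mkord -sum1_card.
  by apply: eq_bigl => k; rewrite coprime_sym.
rewrite -prodr_const; apply: ler_prod => k _; rewrite ler0n /=.
have := lerB_dist (q%:R : algC) (z ^+ k); rewrite normrX.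
have -> : `|z| = 1.
  by apply/eqP; rewrite -(@pexpr_eq1 _ _ n) // -normrX (prim_expr_order prim_z) normr1.
rewrite expr1n normr_nat; apply: le_trans.
by rewrite -{2}(prednK q_gt0) mulrSr addrK.
Qed.

Lemma Cyclotomic_dvd (n d : nat) : (0 < n)%N -> (d %| n)%N -> (d < n)%N ->
  exists r : {poly int}, 'X^n - 1 = 'Phi_n * ('X^d - 1) * r.
Proof.
move=> n_gt0 d_n d_lt_n; have d_gt0 := dvdn_gt0 n_gt0 d_n.
exists (\prod_(e <- divisors n | ~~ (e %| d)%N && (e != n)) 'Phi_e).
rewrite -(prod_Cyclotomic n_gt0) -(prod_Cyclotomic d_gt0).
rewrite (bigD1_seq n) ?divisors_id ?divisors_uniq //= -mulrA; congr (_ * _).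
rewrite (bigID (fun e => e %| d)%N) /=; congr (_ * _).
  rewrite -big_filter -[RHS]big_filter; apply: perm_big; apply: uniq_perm.
  - by rewrite filter_uniq ?divisors_uniq.
  - by rewrite filter_uniq ?divisors_uniq.
  move=> e; rewrite !mem_filter /= -!dvdn_divisors //.
  apply/andP/idP => [[/andP[]] // | e_d]; rewrite e_d (dvdn_trans e_d d_n).
  by split=> //; rewrite andbT; apply: contraTneq d_lt_n => <-; rewrite -leqNgt dvdn_leq.
by apply: eq_bigl => e; rewrite andbC.
Qed.

Lemma Cyclotomic_dvdn (q n d : nat) : (0 < q)%N -> (0 < n)%N -> (d %| n)%N -> (d < n)%N ->
  (`|('Phi_n).[q%:Z]| * (q ^ d).-1 %| (q ^ n).-1)%N.
Proof.
move=> q_gt0 n_gt0 d_n d_lt_n; have [r def_r] := Cyclotomic_dvd n_gt0 d_n d_lt_n.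
have predE e : ((q ^ e).-1)%:Z = ('X^e - 1).[q%:Z].
  have -> : ('X^e - 1).[q%:Z] = q%:Z ^+ e - 1 by rewrite !hornerE.
  rewrite -subn1 -subzn ?expn_gt0 ?q_gt0 //; congr (_ - 1).
  by elim: e => // e IHe; rewrite expnS exprS PoszM IHe.
have : (('Phi_n).[q%:Z] * ((q ^ d).-1)%:Z %| ((q ^ n).-1)%:Z)%Z.
  by rewrite !predE def_r !hornerM dvdz_mulr.
by rewrite dvdzE abszM.
Qed.

Local Open Scope nat_scope.

Lemma dvdn_pred_exp (p q i : nat) : 0 < q -> (p %| (q ^ i).-1) = (q ^ i == 1 %[mod p]).
Proof. by move=> q_gt0; rewrite eqn_mod_dvd ?expn_gt0 ?q_gt0 // subn1. Qed.

Definition primitive_divisor (p q n : nat) :=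
  [/\ prime p, p %| (q ^ n).-1 & forall i, 0 < i < n -> ~~ (p %| (q ^ i).-1)].

Lemma coprime_dvd_pred_exp (p q n : nat) :
  0 < q -> 0 < n -> prime p -> p %| (q ^ n).-1 -> coprime q p.
Proof.
move=> q_gt0 n_gt0 p_pr p_qn; rewrite coprime_sym prime_coprime //.
apply: contraTN p_qn => p_q; apply/negP=> p_qn; have := dvdn_exp n_gt0 p_q.
rewrite -(prednK (_ : 0 < q ^ n)) ?expn_gt0 ?q_gt0 // -addn1 dvdn_addr // dvdn1.
by apply/negP; rewrite neq_ltn prime_gt1 ?orbT.
Qed.

(** [d] is the multiplicative order of [q] modulo [p], at most [p - 1] by Fermat's little
    theorem. *)
Lemma exp_mod_order (p q : nat) : prime p -> coprime q p ->
  exists2 d, 0 < d < p & forall i, (q ^ i == 1 %[mod p]) = (d %| i).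
Proof.
move=> p_pr co_qp.
have exd: exists d, (0 < d) && (q ^ d == 1 %[mod p]).
  exists p.-1; rewrite -ltnS prednK ?prime_gt0 ?prime_gt1 //=.
  by rewrite -(totient_prime p_pr) Euler_exp_totient.
case: (ex_minnP exd) => d /andP[d_gt0 /eqP qd1] d_min; exists d.
  rewrite d_gt0 /=; apply: leq_ltn_trans (d_min p.-1 _) _.
    rewrite -ltnS prednK ?prime_gt0 ?prime_gt1 //=.
    by rewrite -(totient_prime p_pr) Euler_exp_totient.
  by rewrite prednK ?prime_gt0.
move=> i; have -> : q ^ i = q ^ (i %% d) %[mod p].
  rewrite {1}(divn_eq i d) expnD [_ * d]mulnC expnM -modnMml -modnXm qd1 modnXm.
  by rewrite exp1n modnMml mul1n.
apply/eqP/eqP => [qi1 | ->]; last by rewrite expn0.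
apply/eqP; rewrite eqn0Ngt; apply/negP=> i_gt0.
have := d_min (i %% d); rewrite i_gt0 qi1 eqxx leqNgt ltn_pmod //.
by move/(_ isT).
Qed.

Lemma expn1D_mod_square (p t j : nat) : exists u, (1 + p * t) ^ j = 1 + j * (p * t) + p ^ 2 * u.
Proof.
elim: j => [|j [u IHj]]; first by exists 0; rewrite muln0.
by exists (u + j * t ^ 2 + p * t * u); rewrite expnS IHj; lia.
Qed.

(** With [y = 1 + p * t], the sum is [p] plus [p * t] times the sum of all [j < p], modulo [p ^ 2];
    for odd [p] that inner sum is a multiple of [p]. *)
Lemma sum_exp_not_dvd_square (p y : nat) : prime p -> 2 < p -> y = 1 %[mod p] ->
  0 < y -> ~~ (p ^ 2 %| \sum_(j < p) y ^ j).
Proof.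
move=> p_pr p_gt2 /eqP y1 y_gt0; move: y1; rewrite eqn_mod_dvd // => /dvdnP[t].
rewrite mulnC => def_y; have{def_y} ->: y = 1 + p * t by lia.
have [U ->] : exists U, \sum_(j < p) (1 + p * t) ^ j = p + p ^ 2 * U.
  have [v def_v] : exists v, \sum_(j < p) j = v * p.
    by apply/dvdnP; rewrite -(big_mkord xpredT id) bin2_sum prime_dvd_bin.
  have sum_mod k : exists w, \sum_(j < k) (1 + p * t) ^ j =
      \sum_(j < k) (1 + j * (p * t)) + p ^ 2 * w.
    elim: k => [|k [w IHk]]; first by exists 0; rewrite !big_ord0 muln0.
    have [u def_u] := expn1D_mod_square p t k.
    by exists (w + u); rewrite !big_ord_recr /= IHk def_u mulnDr addnACA.
  have [w ->] := sum_mod p.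
  exists (v * t + w); rewrite big_split /= sum1_card card_ord -big_distrl /= def_v mulnDr expnS expn1; lia.
rewrite (dvdn_addl _ (dvdn_mulr U (dvdnn (p ^ 2)))); apply/negP => /(dvdn_leq (prime_gt0 p_pr)).
by rewrite -{2}(expn1 p) leq_exp2l // prime_gt1.
Qed.

Lemma ltn_exp3_pred (r : nat) : 1 < r -> r < 3 ^ r.-1.
Proof.
case: r => [|[|r]] //= _; rewrite expnS.
by have := @ltn_expl 3 r isT; move: (3 ^ r) => t; lia.
Qed.

Lemma square_add1_mod4 (x : nat) : ~~ (2 ^ 2 %| 1 + x * x).
Proof.
rewrite /dvdn -modnDmr -modnMml -modnMmr.
by have := @ltn_pmod x (2 ^ 2) isT; case: (x %% _) => [|[|[|[|]]]].
Qed.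

(* Phi_n(q) is a product of primes p with q ^ (n / p) = 1 mod p when there is no
   primitive prime; p is then the largest prime factor of n, and divides Phi_n(q)
   only once, which contradicts Phi_n(q) >= (q - 1) ^ totient n. *)
Theorem primitive_prime_divisor (q n : nat) : 3 < q -> 2 < n ->
  exists p, primitive_divisor p q n.
Proof.
move=> q_gt3 n_gt2; have q_gt0: 0 < q by apply: leq_trans q_gt3.
have n_gt0: 0 < n by apply: leq_trans n_gt2.
set c := `|(('Phi_n).[q%:Z])%R|.
have c_ge: q.-1 ^ totient n <= c by apply: Cyclotomic_lower_bound.
have c_dvd d : d %| n -> d < n -> c * (q ^ d).-1 %| (q ^ n).-1.
  exact: Cyclotomic_dvdn.
have pred_gt0 i : 0 < i -> 0 < (q ^ i).-1.
  by move=> i_gt0; rewrite -ltnS prednK ?expn_gt0 ?q_gt0 // -(exp1n i) ltn_exp2r // (leq_trans _ q_gt3).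
have c_dvdn: c %| (q ^ n).-1.
  by apply: dvdn_trans (c_dvd 1 (dvd1n n) (ltnW n_gt2)); apply: dvdn_mulr.
have phi_gt0: 0 < totient n by rewrite totient_gt0.
have c_gt2: 2 < c.
  by apply: leq_trans c_ge; apply: leq_trans (leq_pexp2l _ phi_gt0); rewrite ?expn1; lia.
have [/hasP[p p_c /allP p_prim] | /hasPn noprim] := boolP (has
  (fun p => all (fun i => ~~ (p %| (q ^ i).-1)) (iota 1 n.-1)) (primes c)).
  move: p_c; rewrite mem_primes => /and3P[p_pr _ p_c]; exists p; split=> //.
    exact: dvdn_trans p_c c_dvdn.
  by move=> i /andP[i0 i_n]; apply: p_prim; rewrite mem_iota i0 add1n prednK.
exfalso.
(* [o] is the order of [q] modulo [p]; it is less than [n] as [p] is not primitive, and [n / o] is a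
   power of [p]. *)
have key p : prime p -> p %| c -> exists o a, [/\ n = o * p ^ a, 0 < o < p, 0 < a & q ^ (n %/ p) = 1 %[mod p]].
  move=> p_pr p_c; have p_qn := dvdn_trans p_c c_dvdn.
  have co_qp := coprime_dvd_pred_exp q_gt0 n_gt0 p_pr p_qn.
  have [o /andP[o_gt0 o_p] oP] := exp_mod_order p_pr co_qp.
  have o_n: o %| n by rewrite -oP -dvdn_pred_exp.
  have: p \in primes c by rewrite mem_primes p_pr p_c (leq_trans _ c_gt2).
  move/noprim => /allPn[i]; rewrite mem_iota add1n prednK // negbK dvdn_pred_exp // oP => /andP[i0 i_n] o_i.
  have o_lt_n: o < n by apply: leq_ltn_trans i_n; apply: dvdn_leq.
  (* With [y = q ^ (n / l)], which is 1 modulo [p], [c] divides [(y ^ l - 1) / (y - 1)], and this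
     quotient is [l] modulo [p]. *)
  have ell l : prime l -> l %| n %/ o -> l = p.
    move=> l_pr l_no; set d := n %/ l.
    have l_n: l %| n by apply: dvdn_trans l_no _; apply: dvdn_div.
    have d_n: d %| n by apply: dvdn_div.
    have d_lt: d < n by rewrite ltn_Pdiv ?prime_gt1.
    have d_gt0 : 0 < d by rewrite divn_gt0 ?prime_gt0 // dvdn_leq.
    have qd1: q ^ d == 1 %[mod p].
      by rewrite oP /d -(divnK o_n) -divn_mulAC // dvdn_mull.
    have := c_dvd d d_n d_lt; rewrite -{1}(divnK l_n) expnM (predn_exp (q ^ (n %/ l))) -/d mulnC.
    rewrite dvdn_pmul2l ?pred_gt0 // => c_sum.
    have: p %| \sum_(j < l) (q ^ d) ^ j by apply: dvdn_trans p_c c_sum.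
    rewrite /dvdn -modn_summ (eq_bigr (fun=> 1 %% p)) => [|j _]; last first.
      by rewrite -modnXm (eqP qd1) modnXm exp1n.
    rewrite modn_summ sum1_card card_ord -/(p %| l) dvdn_prime2 //.
    by move/eqP.
  have no_gt1: 1 < n %/ o by rewrite ltn_divRL ?mul1n.
  have no_p: n %/ o = p ^ logn p (n %/ o).
    rewrite -p_part part_pnat_id //; apply/pnatP; first exact: ltnW.
    by move=> l l_pr l_no; rewrite inE /= (ell l).
  have a_gt0: 0 < logn p (n %/ o).
    by rewrite lt0n; apply: contraTneq no_gt1 => a0; rewrite no_p a0.
  exists o, (logn p (n %/ o)); rewrite -no_p mulnC divnK // o_gt0; split=> //.
  apply/eqP; rewrite oP -(divnK o_n) no_p -(prednK a_gt0) expnSr mulnAC mulnK ?prime_gt0 //.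
  exact: dvdn_mull.
have [p p_pr p_c] : exists2 p, prime p & p %| c.
  by exists (pdiv c); rewrite ?pdiv_prime ?pdiv_dvd // ltnW.
(* [p2] divides [n = o * p1 ^ a], hence [o], and [o < p1]. By symmetry [c] has only one prime
   factor. *)
have lt_key p1 p2 : prime p1 -> p1 %| c -> prime p2 -> p2 %| c -> p1 != p2 -> p2 < p1.
  move=> pr1 c1 pr2 c2 ne; have [o [a [n_eq /andP[o0 o_lt] a0 _]]] := key _ pr1 c1.
  have [o2 [a2 [n_eq2 _ a20 _]]] := key _ pr2 c2.
  have: p2 %| n by rewrite n_eq2 dvdn_mull // dvdn_exp.
  rewrite n_eq Euclid_dvdM // Euclid_dvdX // a0 andbT (dvdn_prime2 pr2 pr1) [p2 == _]eq_sym (negbTE ne) orbF.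
  by move=> /(dvdn_leq o0) le; apply: leq_ltn_trans o_lt.
have c_p: c = p ^ logn p c.
  rewrite -p_part part_pnat_id //; apply/pnatP; first by apply: leq_trans c_gt2.
  move=> l l_pr l_c; rewrite inE /=; apply/eqP; case: (eqVneq l p) => // ne.
  have l1 := lt_key _ _ l_pr l_c p_pr p_c ne.
  by rewrite eq_sym in ne; have := lt_key _ _ p_pr p_c l_pr l_c ne; lia.
have [o [a [n_eq /andP[o0 o_lt] a0 qy]]] := key _ p_pr p_c.
have p_n: p %| n by rewrite n_eq dvdn_mull // dvdn_exp.
(* [c] divides the sum of the first [p] powers of [q ^ (n / p)]. For [p = 2], [n] is a power of 2
   and at least 4, so this sum is 1 plus a square. *)
have p2_c : ~~ (p ^ 2 %| c).
  have d_dvd: n %/ p %| n by apply: dvdn_div.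
  have d_gt0: 0 < n %/ p by rewrite divn_gt0 ?prime_gt0 // dvdn_leq.
  have := c_dvd _ d_dvd (ltn_Pdiv (prime_gt1 p_pr) n_gt0).
  rewrite -{2}(divnK p_n) expnM (predn_exp (q ^ (n %/ p))) mulnC dvdn_pmul2l ?pred_gt0 // => c_sum.
  apply/negP=> /dvdn_trans/(_ c_sum); apply/negP.
  have [p_gt2|p_le2] := ltnP 2 p; first by apply: sum_exp_not_dvd_square; rewrite ?expn_gt0 ?q_gt0.
  have p2: p = 2 by have := prime_gt1 p_pr; lia.
  have o1: o = 1 by move: o0 o_lt; rewrite p2; case: (o) => [|[]].
  rewrite p2 !big_ord_recr big_ord0 /= expn0 expn1.
  move: n_gt2 qy a0; rewrite n_eq o1 p2 mul1n; case: (a) => [|[|b]] // _.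
  by rewrite [2 ^ b.+2]expnS mulKn // expnS mul2n -addnn expnD !add0n square_add1_mod4.
have c_le: c <= p.
  rewrite c_p -[X in _ <= X]expn1 leq_exp2l ?prime_gt1 // leqNgt; apply: contra p2_c => l2.
  by rewrite c_p dvdn_exp2l.
have p_phi: p.-1 <= totient n.
  rewrite n_eq totient_coprime; last first.
    by rewrite coprimeXr // coprime_sym prime_coprime //; apply: contraL o_lt => /(dvdn_leq o0); rewrite -leqNgt.
  rewrite totient_pfactor // mulnCA leq_pmulr // muln_gt0 expn_gt0 (prime_gt0 p_pr) andbT.
  by rewrite totient_gt0 o0.
have: 3 ^ p.-1 <= p.
  apply: leq_trans c_le; apply: leq_trans c_ge; apply: (@leq_trans (3 ^ totient n)).
    by rewrite leq_exp2l.
  by rewrite leq_exp2r // -ltnS prednK.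
by rewrite leqNgt ltn_exp3_pred ?prime_gt1.
Qed.

(** * Linear groups containing an element of primitive prime order *)

Section Representation.
Variables (F : finFieldType) (gT : finGroupType).
Implicit Types (G X N : {group gT}) (n p : nat).

Lemma primitive_divisor_coprime p n : 0 < n -> primitive_divisor p #|F| n -> coprime #|F| p.
Proof.
by move=> n_gt0 [p_pr p_qn _]; apply: coprime_dvd_pred_exp p_qn; rewrite // ltnW ?finNzRing_gt1.
Qed.

(** [p] is prime to [q = #|F|], so it divides [q ^ (j - i) - 1]; primitivity leaves only [j - i = 0]
    or [j - i = n]. *)
Lemma primitive_divisor_eqmod p n i j : primitive_divisor p #|F| n ->
  0 < n -> i <= j <= n -> #|F| ^ i = #|F| ^ j %[mod p] -> i = j \/ (i = 0 /\ j = n).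
Proof.
move=> ppd n_gt0 /andP[le_ij le_jn] /eqP; rewrite eq_sym.
rewrite eqn_mod_dvd; last by rewrite leq_pexp2l // ltnW ?finNzRing_gt1.
rewrite -{1}(subnKC le_ij) expnD -{2}[_ ^ i]muln1 -mulnBr subn1 Gauss_dvdr; last first.
  by rewrite coprimeXr // coprime_sym (primitive_divisor_coprime n_gt0).
case: ppd => _ _ ppd; have := ppd (j - i); case: (posnP (j - i)) => [|_]; first by left; lia.
case: (ltnP (j - i) n) => [_ /(_ isT) /negPf-> // | le _ _]; by right; lia.
Qed.

(** A submodule and its fixed subspace have the same number of vectors modulo [p]. On the whole
    space, faithfulness then makes the fixed subspace 0; so [#|F| ^ \rank U] is 1 modulo [p] for
    every submodule [U]. *)
Lemma prime_order_mx_irr X n (rX : mx_representation F X n) p :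
    primitive_divisor p #|F| n -> 0 < n -> #|X| = p -> mx_faithful rX ->
  mx_irreducible rX.
Proof.
case: n rX => // n rX ppd n_gt0 oX fX; have [p_pr _ _] := ppd.
have pX : p.-group X by rewrite /pgroup oX pnat_id.
have fixU (U : 'M[F]_n.+1) : mxmodule rX U ->
    #|F| ^ \rank U = #|F| ^ \rank (U :&: rfix_mx rX X)%MS %[mod p].
  rewrite -acts_rowg => /(pgroup_fix_mod pX).
  by rewrite afix_repr // -rowgI !card_rowg.
have rfix0: rfix_mx rX X = 0%R.
  have := fixU 1%:M%R (mxmodule1 _); rewrite mxrank1 cap1mx => /esym eq_mod.
  have := primitive_divisor_eqmod ppd n_gt0 _ eq_mod; rewrite rank_leq_row leqnn => /(_ isT).
  case=> [full | [/eqP]]; last by rewrite mxrank_eq0 => /eqP.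
  case/eqP: (prime_gt1 p_pr) => /=; rewrite -oX.
  suff -> : X :=: 1%g by rewrite cards1.
  apply/trivgP; apply: subset_trans fX; apply/subsetP=> x Xx.
  rewrite inE Xx mul1mx /=; apply/eqP.
  have fixU1 : ((1%:M)%R <= rfix_mx rX X)%MS by rewrite sub1mx /row_full full.
  by have /rfix_mxP/(_ x Xx) := fixU1; rewrite mul1mx.
apply/mx_irrP; split=> // U modU nzU; have := fixU U modU.
rewrite rfix0 capmx0 mxrank0 => /esym eq_mod.
have := primitive_divisor_eqmod ppd n_gt0 _ eq_mod; rewrite rank_leq_row => /(_ isT).
by rewrite /row_full; case=> [/esym/eqP|[_ ->]] //; rewrite mxrank_eq0 (negbTE nzU).
Qed.

Local Open Scope ring_scope.

(** Some [E] in the enveloping algebra agrees with [A] on a nonzero vector [v]; [A - E] commutes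
    with the action and kills [v], so it is 0 by Schur's lemma. *)
Lemma irr_abelian_cent_envelop X n (rX : mx_representation F X n) (A : 'M_n) :
  mx_irreducible rX -> abelian X -> centgmx rX A ->
  (A \in enveloping_algebra_mx rX)%MS.
Proof.
move=> irrX abX cXA; have [n_gt0 irr] := (mx_irrP rX).1 irrX.
pose v : 'rV[F]_n := delta_mx 0 (Ordinal n_gt0).
have v_nz: v != 0.
  by apply/eqP=> /rowP/(_ (Ordinal n_gt0))/eqP; rewrite !mxE !eqxx oner_eq0.
have: (v *m A <= cyclic_mx rX v)%MS.
  by apply: submx_full; apply: irr; rewrite ?cyclic_mx_module ?cyclic_mx_eq0.
case/cyclic_mxP=> E envE vA_vE; suff -> : A = E by [].
apply/eqP; rewrite -subr_eq0; apply/idPn=> nzAE.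
have cXE : centgmx rX E.
  apply/centgmxP=> x Xx; have /envelop_mxP[a ->] := envE.
  rewrite mulmx_suml mulmx_sumr; apply: eq_bigr => y Xy.
  by rewrite -scalemxAl -scalemxAr -!repr_mxM // (centsP abX).
have uAE: A - E \in unitmx.
  apply: (mx_Schur irrX) => //; apply/centgmxP=> x Xx.
  by rewrite mulmxBl mulmxBr (centgmxP cXA) // (centgmxP cXE).
case/eqP: v_nz; apply: (can_inj (mulmxK uAE)).
by rewrite mulmxBr vA_vE subrr mul0mx.
Qed.

Lemma irr_abelian_cent_comm X n (rX : mx_representation F X n) (A B : 'M_n) :
  mx_irreducible rX -> abelian X -> centgmx rX A -> centgmx rX B ->
  A *m B = B *m A.
Proof.
move=> irrX abX cXA; rewrite -memmx_cent_envelop => /cent_mxP cB.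
by rewrite cB // irr_abelian_cent_envelop.
Qed.

(** ['C_G(X)] is abelian because matrices centralising [X] commute; it is irreducible because it
    contains [X], and a faithful irreducible abelian group is cyclic. *)
Lemma cent_irr_cyclic G n (rG : mx_representation F G n) X (sXG : X \subset G) :
  mx_faithful rG -> mx_irreducible (subg_repr rG sXG) -> abelian X ->
  cyclic 'C_G(X).
Proof.
move=> fG irrX abX; have sCG := subsetIl G 'C(X).
have cG_cent x : x \in 'C_G(X) -> centgmx (subg_repr rG sXG) (rG x).
  case/setIP=> Gx cXx; apply/centgmxP=> y Xy /=.
  have Gy := subsetP sXG y Xy; have cxy : (x * y = y * x)%g by apply: (centP cXx).
  by rewrite -!repr_mxM // cxy.
apply: (mx_faithful_irr_abelian_cyclic (rG := subg_repr rG sCG)).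
- by apply: subg_mx_faithful.
- have sXC: X \subset 'C_G(X) by rewrite subsetI sXG.
  apply: (@subg_mx_irr _ _ _ _ _ _ sXC); apply/mx_irrP.
  by have [n_gt0 irr] := (mx_irrP _).1 irrX.
apply/centsP=> x Cx y Cy; have [Gx _] := setIP Cx; have [Gy _] := setIP Cy.
apply: (mx_faithful_inj fG); rewrite ?groupM // !repr_mxM //.
by apply: (irr_abelian_cent_comm irrX); rewrite ?cG_cent.
Qed.

(** By Cayley-Hamilton the conjugates of [a] are roots of its characteristic polynomial, of degree
    [n]. Over a ring, the degree still bounds the number of commuting roots with invertible
    differences. *)
Lemma conj_commute_card G n (rG : mx_representation F G n) (a : gT) (S : {set gT}) :
    (0 < n)%N -> mx_faithful rG -> a \in G -> S \subset a ^: G ->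
    {in S &, forall x y, commute x y} ->
    {in S &, forall x y, x != y -> rG x - rG y \in unitmx} ->
  (#|S| <= n)%N.
Proof.
case: n rG => // n rG _ fG Ga sSa cS uS.
have sSG : {subset S <= G}.
  by move=> x /(subsetP sSa); apply: subsetP; rewrite class_subG.
pose P := map_poly (@scalar_mx F n.+1) (char_poly (rG a)).
have szP : size P = n.+2 by rewrite size_map_poly size_char_poly.
rewrite -ltnS -szP -(size_image rG (mem S)).
apply: max_ring_poly_roots; first by rewrite -size_poly_eq0 szP.
  apply/allP=> _ /imageP[x Sx ->]; have /imsetP[h Gh ->] := subsetP sSa x Sx.
  have := horner_mx_uconjC (char_poly (rG a)) (rG a) (repr_mx_unit rG Gh).
  rewrite Cayley_Hamilton mulmx0 mul0mx -repr_mxV // -!repr_mxM ?groupM ?groupV //.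
  by rewrite -mulgA -conjgE => /eqP.
rewrite /image_mem; have := enum_uniq (mem S).
have: {subset enum (mem S) <= S} by move=> x; rewrite mem_enum.
elim: (enum _) => //= x s IHs sS /andP[nsx us]; apply/andP; split; last first.
  by apply: IHs => // y sy; apply: sS; rewrite inE sy orbT.
apply/allP=> _ /mapP[y sy ->]; have [Sx Sy] : x \in S /\ y \in S.
  by split; apply: sS; rewrite inE ?eqxx ?sy ?orbT.
apply/andP; split.
  by apply/eqP; rewrite -!mulmxE -!repr_mxM ?sSG // cS.
by apply: uS => //; apply: contraNneq nsx => <-.
Qed.

(** The kernel of [b] is a submodule. If nonzero, it contains a simple [M]; then [b] kills every
    copy of [M], hence everything. *)
Lemma simple_component_envelop_unit N n (rN : mx_representation F N n) (b : 'M_n) :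
    abelian N -> (forall M, mxsimple rN M -> (1%:M <= component_mx rN M)%MS) ->
    (b \in enveloping_algebra_mx rN)%MS -> b != 0 -> b \in unitmx.
Proof.
move=> abN comp1 Eb; rewrite -row_free_unit -kermx_eq0; apply: contraR => nz_ker.
have cNb : centgmx rN b.
  apply/centgmxP=> x Nx; have /envelop_mxP[a ->] := Eb.
  rewrite mulmx_suml mulmx_sumr; apply: eq_bigr => y Ny.
  by rewrite -scalemxAl -scalemxAr -!repr_mxM // (centsP abN).
apply: (mxsimple_exists (kermx_centg_module cNb) nz_ker) => -[M simM sMker].
have [I [W isoW defV]] := component_mx_def simM.
rewrite -[b]mul1mx -submx0; apply: submx_trans (submxMr b (comp1 M simM)) _.
rewrite defV sumsmxMr; apply/sumsmx_subP=> i _.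
have [f _ homf defW] := isoW i; rewrite -(eqmxMr b defW) -(hom_envelop_mxC homf Eb).
by rewrite (sub_kermxP sMker) mul0mx.
Qed.

(** By Clifford's theorem [Y] permutes the homogeneous components of [N] transitively. Their number
    divides [p] and also the rank [n < p], so it is 1. *)
Lemma irr_normal_component (Y N : {group gT}) n (rY : mx_representation F Y n) (nsNY : N <| Y) p M :
    mx_irreducible rY -> prime p -> (#|Y : N| %| p)%N -> (n < p)%N ->
    mxsimple (subg_repr rY (normal_sub nsNY)) M ->
  (1%:M <= component_mx (subg_repr rY (normal_sub nsNY)) M)%MS.
Proof.
move=> irrY p_pr dvd_YN lt_np simM; set rN := subg_repr _ _ in simM *.
apply: (@socle_exists _ _ _ _ rN) => sN.
have n_gt0: (0 < n)%N by case/mx_irrP: irrY.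
pose W : sN := PackSocle (component_socle sN simM).
have dvd_p: (#|sN| %| p)%N.
  have := atrans_dvd_index_in (subxx _) (Clifford_atrans irrY sN).
  rewrite cardsT => /dvdn_trans; apply.
  have := Clifford_astab (rG := rY) sN.
  rewrite join_subG => /andP[sNC _].
  have sNC' : N \subset 'C_Y([set: sN] | 'Cl)%act by rewrite subsetI normal_sub.
  exact: dvdn_trans (indexgS _ sNC') dvd_YN.
have rkW := Clifford_rank_components irrY W.
have sN1: #|sN| = 1%N.
  case/primeP: p_pr => _ /(_ _ dvd_p)/orP[/eqP // | /eqP sNp].
  case/negP: (ltn_geF lt_np); move: rkW n_gt0; rewrite sNp; move: (\rank W) => k <-.
  by rewrite muln_gt0 => /andP[_ k_gt0]; rewrite leq_pmulr.
by move: rkW; rewrite sN1 mul1n PackSocleK sub1mx /row_full => ->.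
Qed.

(** [N] is homogeneous, so differences of distinct elements are invertible and [a] has at most
    [n < p] conjugates under [<[g]>]; their number divides [p], so it is 1. *)
Lemma abelian_normalised_cent G n (rG : mx_representation F G n) N g p :
    mx_faithful rG -> N \subset G -> g \in G -> g \in 'N(N) -> abelian N ->
    #[g]%g = p -> prime p -> (n < p)%N ->
    (forall sgG : <[g]>%g \subset G, mx_irreducible (subg_repr rG sgG)) ->
  N \subset 'C[g].
Proof.
move=> fG sNG Gg nNg abN og p_pr lt_np irrg; apply/subsetP=> a Na.
pose Y := (N <*> <[g]>)%G.
have sgG: <[g]>%g \subset G by rewrite cycle_subG.
have sYG: Y \subset G by rewrite join_subG sNG.
have nsNY: N <| Y by rewrite /normal joing_subl join_subG normG cycle_subG.
have sgY: <[g]>%g \subset Y by rewrite joing_subr.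
pose rY := subg_repr rG sYG; pose rN := subg_repr rY (normal_sub nsNY).
have fY: mx_faithful rY by apply: subg_mx_faithful.
have irrY: mx_irreducible rY.
  apply: (@subg_mx_irr _ _ _ _ _ _ sgY); apply/mx_irrP.
  by have [n_gt0 irr] := (mx_irrP _).1 (irrg sgG).
have dvd_YN: (#|Y : N| %| p)%N.
  rewrite /= norm_joinEr ?cycle_subG // indexMg -indexgI /= -og.
  exact: dvdn_indexg.
have n_gt0: (0 < n)%N by case/mx_irrP: irrY.
have Ya : a \in Y by apply: (subsetP (normal_sub nsNY)).
have comp1 M : mxsimple rN M -> (1%:M <= component_mx rN M)%MS.
  exact: irr_normal_component irrY p_pr dvd_YN lt_np.
have sSN : a ^: <[g]> \subset N.
  by rewrite class_sub_norm // cycle_subG.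
have leS: (#|a ^: <[g]>%g| <= n)%N.
  apply: (conj_commute_card n_gt0 fY Ya (classS a sgY)) => x y Sx Sy.
    by apply: (centsP abN); apply: (subsetP sSN).
  move=> ne_xy; have [Nx Ny] : x \in N /\ y \in N by split; apply: (subsetP sSN).
  apply: (simple_component_envelop_unit (rN := rN)) => //.
    rewrite linearB /= addmx_sub ?eqmx_opp //; first by apply: (envelop_mx_id rN).
    by apply: (envelop_mx_id rN).
  by rewrite subr_eq0 (inj_in_eq (mx_faithful_inj fY)) // (subsetP (normal_sub nsNY)).
have: (#|a ^: <[g]>%g| %| p)%N by rewrite -index_cent1 -og dvdn_indexg.
case/primeP: (p_pr) => _ /[apply]/orP[ | /eqP Sp]; last first.
  by rewrite Sp leqNgt lt_np in leS.
rewrite -index_cent1 indexg_eq1 => /subsetP/(_ g (cycle_id g)).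
by case/setIP=> _; rewrite cent1C.
Qed.

(** A shortest-relation argument with coefficients in a set [K] of matrices commuting with [N].
    Conjugation by [y] multiplies the term at [x] by the central element [[~ x, y]]; subtracting the
    relation times [[~ x0, y]] removes the term at [x0]. *)
Lemma center_cosets_independent N n (rN : mx_representation F N n) (T : {set gT})
    (K : pred 'M[F]_n) (e : gT -> 'M_n) :
    mx_faithful rN -> T \subset N -> [~: N, N]%g \subset 'Z(N) ->
    {in T &, forall x y, (x^-1 * y)%g \in 'Z(N) -> x = y} ->
    (forall A x, A \in K -> x \in N -> A *m rN x = rN x *m A) ->
    (forall A x y, A \in K -> x \in 'Z(N) -> y \in 'Z(N) -> A *m (rN x - rN y) \in K) ->
    (forall A x y, A \in K -> x \in 'Z(N) -> y \in 'Z(N) -> x != y ->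
        A *m (rN x - rN y) = 0 -> A = 0) ->
    (forall x, e x \in K) ->
    \sum_(x in T) e x *m rN x = 0 ->
  {in T, forall x, e x = 0}.
Proof.
move=> fN sTN cl2 injT cK subK regK; pose supp (e : gT -> 'M[F]_n) := [set x in T | (e x != 0)%R].
move: {2}#|supp e|.+1 (ltnSn #|supp e|) => k.
elim: k e => // k IHk e; rewrite ltnS => le_k eK rel x0 Tx0; apply/eqP; apply: contraTT isT => nz0.
have [x1 /andP[Tx1 /andP[nz1 ne10]] | only0] :=
    pickP [pred x | (x \in T) && ((e x != 0) && (x != x0))]; last first.
  move: rel; rewrite (bigD1 x0) //= big1 ?addr0 => [e0 | x /andP[Tx ne]]; last first.
    have := only0 x; rewrite inE /= Tx ne andbT => /negbFE/eqP ->.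
    by rewrite mul0mx.
  case/eqP: nz0; rewrite -[e x0]mulmx1 -(repr_mx1 rN) -(mulgV x0).
  by rewrite repr_mxM ?groupV ?(subsetP sTN) // mulmxA e0 mul0mx.
have [N0 N1] : x0 \in N /\ x1 \in N by split; apply: (subsetP sTN).
have nzv: (x0^-1 * x1)%g \notin 'Z(N).
  by apply: contra ne10 => /(injT _ _ Tx0 Tx1) ->.
(* If the two commutators agreed for all [y], then [x0^-1 * x1] would be central. This choice keeps
   the new coefficient at [x1] nonzero. *)
have [y Ny ncy]: exists2 y, y \in N & [~ x0, y]%g != [~ x1, y]%g.
  move: nzv; rewrite inE groupM ?groupV //= -sub_cent1 => /subsetPn[y Ny ncy].
  exists y => //; apply: contra ncy => /eqP eq01.
  have /setIP[_ /centP cz] : [~ x1, y]%g \in 'Z(N) by rewrite (subsetP cl2) ?mem_commg.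
  have cw : commute (x0^-1 * x1)%g y.
    apply/commgP/conjg_fixP; rewrite conjMg conjVg !conjg_mulR eq01 invMg.
    apply: (mulgI [~ x1, y]%g); rewrite [RHS]cz ?groupM ?groupV //.
    by rewrite !mulgA mulgV mul1g.
  by apply/cent1P.
pose z x := [~ x, y]%g.
have Zz x : x \in T -> z x \in 'Z(N).
  by move=> Tx; rewrite (subsetP cl2) // mem_commg // (subsetP sTN).
have Nz x : x \in T -> z x \in N by move/Zz/setIP=> [].
pose e' x := if x \in T then e x *m (rN (z x) - rN (z x0)) else e x.
have e'K x : e' x \in K by rewrite /e'; case: ifP => // Tx; apply: subK; rewrite ?Zz.
have rel' : \sum_(x in T) e' x *m rN x = 0.
  transitivity (rN y^-1%g *m (\sum_(x in T) e x *m rN x) *m rN y -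
                rN (z x0) *m (\sum_(x in T) e x *m rN x)); last first.
    by rewrite rel !mulmx0 mul0mx subrr.
  rewrite !mulmx_sumr mulmx_suml -sumrB; apply: eq_bigr => x Tx.
  have Nx := subsetP sTN x Tx.
  rewrite /e' Tx mulmxBr mulmxBl; congr (_ - _).
    rewrite mulmxA -(cK _ _ (eK x)) ?groupV // -!mulmxA; congr (_ *m _).
    rewrite -!repr_mxM ?groupM ?groupV ?Nz //.
    have /setIP[_ /centP cz] := Zz x Tx; rewrite (cz x) // /z commgEl.
    by rewrite mulKVg conjgE.
  by rewrite mulmxA (cK _ _ (eK x)) ?Nz.
have := IHk e' _ e'K rel' x1 Tx1; rewrite /e' Tx1 => e'0.
have {}e'0 : e x1 = 0.
  apply: (regK _ (z x1) (z x0)); rewrite ?Zz ?e'0 //; first by rewrite eq_sym.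
  apply: leq_trans le_k; apply: proper_card; apply/properP; split.
    apply/subsetP=> x; rewrite !inE => /andP[Tx]; rewrite /e' Tx.
    by apply: contraNneq => ->; rewrite mul0mx.
  exists x0; first by rewrite inE Tx0.
  by rewrite inE /e' Tx0 subrr mulmx0 eqxx.
by rewrite e'0 eqxx in nz1.
Qed.

(** Coset representatives of ['Z(N)] are linearly independent in the matrix algebra, of dimension
    [n ^ 2]; in case of equality they span it. *)
Lemma center_index_leq G N n (rG : mx_representation F G n) (sNG : N \subset G) X
    (sXG : X \subset G) :
    mx_faithful rG -> mx_irreducible (subg_repr rG sXG) ->
    [~: N, N]%g \subset 'Z(N) -> 'Z(N) \subset 'C(X) ->
  (#|N : 'Z(N)| <= n ^ 2)%N /\
  (#|N : 'Z(N)| = n ^ 2 -> mx_absolutely_irreducible (subg_repr rG sNG))%N.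
Proof.
move=> fG irrX cl2 cXZ; pose rN := subg_repr rG sNG; pose rX := subg_repr rG sXG.
pose T := [set repr C | C in rcosets 'Z(N) N].
have TP x : x \in T -> exists2 y, y \in N & x = repr ('Z(N) :* y).
  by case/imsetP=> C /rcosetsP[y Ny ->] ->; exists y.
have sTN : T \subset N.
  apply/subsetP=> x /TP[y Ny ->]; have := mem_repr_rcoset 'Z(N) y.
  by apply: subsetP; rewrite mul_subG ?sub1set ?center_sub.
have injT : {in T &, forall x y, (x^-1 * y)%g \in 'Z(N) -> x = y}.
  move=> x y Tx Ty Zxy; have Nx := subsetP sTN x Tx.
  have /rcoset_eqP : y \in 'Z(N) :* x.
    rewrite mem_rcoset; have /setIP[_ /centP/(_ _ Nx) cxy] := Zxy.
    by rewrite -(mulKVg x y) -cxy mulgK.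
  have [[x0 N0 ->] [y0 N1 ->]] := (TP x Tx, TP y Ty).
  by rewrite !rcoset_repr => ->.
have cardT : #|T| = #|N : 'Z(N)|%g.
  apply: card_in_imset => _ _ /rcosetsP[x _ ->] /rcosetsP[y _ ->] eq_xy.
  by rewrite -(rcoset_repr _ x) eq_xy rcoset_repr.
pose K : pred 'M[F]_n := [pred A | centgmx rX A && centgmx rN A].
have ZG x : x \in 'Z(N) -> x \in G by case/setIP=> /(subsetP sNG).
have cXmx x : x \in 'Z(N) -> centgmx rX (rG x).
  move=> Zx; have Gx := ZG x Zx; apply/centgmxP=> y Xy /=; have Gy := subsetP sXG y Xy.
  have cxy : (x * y = y * x)%g by apply: (centP (subsetP cXZ x Zx)).
  by rewrite -!repr_mxM // cxy.
have cNmx x : x \in 'Z(N) -> centgmx rN (rG x).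
  move=> Zx; have Gx := ZG x Zx; apply/centgmxP=> y Ny /=; have Gy := subsetP sNG y Ny.
  have cxy : (x * y = y * x)%g by have /setIP[_ /centP] := Zx; apply.
  by rewrite -!repr_mxM // cxy.
have centM (H : {group gT}) (r : mx_representation F H n) (A B C : 'M_n) :
    centgmx r A -> centgmx r B -> centgmx r C -> centgmx r (A *m (B - C)).
  move=> /centgmxP cA /centgmxP cB /centgmxP cC; apply/centgmxP=> x Hx.
  by rewrite -mulmxA mulmxBl cB // cC // -mulmxBr [LHS]mulmxA cA // -mulmxA.
have centS (H : {group gT}) (r : mx_representation F H n) a : centgmx r a%:M.
  by apply/centgmxP=> x _; rewrite scalar_mxC.
have cK A x : A \in K -> x \in N -> A *m rN x = rN x *m A.
  by case/andP=> _ /centgmxP cA /cA.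
have subK A x y : A \in K -> x \in 'Z(N) -> y \in 'Z(N) -> A *m (rN x - rN y) \in K.
  by case/andP=> cXA cNA Zx Zy; rewrite inE !centM ?cXmx ?cNmx.
have regK A x y : A \in K -> x \in 'Z(N) -> y \in 'Z(N) -> x != y ->
    A *m (rN x - rN y) = 0 -> A = 0.
  move=> KA Zx Zy ne_xy; have uxy : rN x - rN y \in unitmx.
    apply: (mx_Schur irrX); last first.
      by rewrite subr_eq0 (inj_in_eq (mx_faithful_inj fG)) ?ZG.
    by rewrite -[_ - _]mul1mx centM ?cXmx.
  by move/(canRL (mulmxK uxy)); rewrite mul0mx.
have fN : mx_faithful rN by apply: subg_mx_faithful.
pose B := \matrix_(i < #|T|) mxvec (rN (enum_val i)).
have freeB : row_free B.
  apply: inj_row_free => v vB0.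
  pose e x := \sum_(i | enum_val i == x) (v 0 i)%:M : 'M[F]_n.
  have eE i : e (enum_val i) = (v 0 i)%:M.
    by rewrite /e (big_pred1 i) // => j; rewrite (inj_eq enum_val_inj).
  have Ksc (a : F) : a%:M \in K by rewrite inE !centS.
  have eK x : e x \in K.
    rewrite /e; apply: (big_ind (fun A => A \in K)) => [|A C|i _]; last exact: Ksc.
      by have -> : 0 = 0%:M :> 'M[F]_n by rewrite raddf0.
    move=> /andP[/centgmxP cA /centgmxP cA'] /andP[/centgmxP cC /centgmxP cC'].
    apply/andP; split; apply/centgmxP=> y Hy; rewrite mulmxDl mulmxDr.
      by rewrite cA ?cC.
    by rewrite cA' ?cC'.
  have rel : \sum_(x in T) e x *m rN x = 0.
    rewrite big_enum_val /=; apply: (can_inj mxvecK); rewrite linear0 -vB0 mulmx_sum_row linear_sum.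
    by apply: eq_bigr => i _; rewrite rowK eE mul_scalar_mx linearZ.
  apply/rowP=> i; have := center_cosets_independent fN sTN cl2 injT cK subK regK eK rel.
  have n_gt0: (0 < n)%N by case/mx_irrP: irrX.
  move/(_ _ (enum_valP i))/matrixP/(_ (Ordinal n_gt0) (Ordinal n_gt0)).
  by rewrite eE !mxE eqxx.
rewrite -cardT -mulnn; split; first by rewrite -(eqP freeB) rank_leq_col.
move=> cardTn; have n_gt0: (0 < n)%N by case/mx_irrP: irrX.
rewrite /mx_absolutely_irreducible n_gt0 -sub1mx.
have fullB: row_full B by rewrite /row_full (eqP freeB) cardTn.
rewrite -sub1mx in fullB; apply: submx_trans fullB _; apply/row_subP=> i.
by rewrite rowK; apply: (envelop_mx_id rN); rewrite (subsetP sTN) ?enum_valP.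
Qed.

End Representation.

(** * Groups with central commutators in a subgroup of prime order *)

Section SquareIndex.
Local Open Scope group_scope.
Variable gT : finGroupType.
Implicit Types (H N D : {group gT}).

(** [D] is generated by [c = [~ u, v]], and [v ^+ i] conjugates [u] to [u * c ^+ i]; both classes
    are therefore the coset [u *: D]. *)
Lemma class_prime_commutators H D (u v : gT) : prime #|D| ->
    (forall h, h \in H -> [~ u, h] \in D) -> v \in H -> [~ u, v] != 1 ->
    commute v [~ u, v] ->
  u ^: H = u ^: <[v]> /\ #|u ^: H| = #|D|.
Proof.
move=> prD Dc Hv nt_c cvc; set c := [~ u, v] in nt_c cvc *.
have defD : D :=: <[c]>.
  have := order_dvdG (Dc v Hv); case/primeP: (prD) => _ /[apply].
  rewrite order_eq1 (negbTE nt_c) /= => /eqP oc.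
  by apply/esym/eqP; rewrite eqEcard cycle_subG Dc //= -orderE oc.
have sDv : u *: D \subset u ^: <[v]>.
  apply/subsetP=> z /lcosetP[d]; rewrite defD => /cycleP[i ->] ->.
  apply/imsetP; exists (v ^+ i); rewrite ?mem_cycle //.
  by rewrite conjg_mulR commgX.
have svH : u ^: <[v]> \subset u ^: H by rewrite classS ?cycle_subG.
have sHD : u ^: H \subset u *: D.
  by apply/subsetP=> _ /imsetP[h Hh ->]; rewrite conjg_mulR mem_lcoset mulKg Dc.
split; last by rewrite -(card_lcoset D u); apply/eqP; rewrite eqn_leq !subset_leq_card // (subset_trans sDv).
by apply/eqP; rewrite eqEsubset svH (subset_trans sHD).
Qed.

(** The commutator acts as a symplectic form on [N / 'Z(N)], from which a hyperbolic pair [x], [y]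
    is split off: the centraliser [N1] of both has index [#|D| ^ 2] and the same centre as [N]. *)
Lemma center_index_square N D : prime #|D| -> [~: N, N] \subset 'Z(N) ->
    {in N &, forall x y, [~ x, y] \in D} ->
  exists s, #|N : 'Z(N)| = (s ^ 2)%N.
Proof.
move=> prD; move: {2}#|N|.+1 (ltnSn #|N|) => k.
elim: k N => // k IHk N; rewrite ltnS => le_k cl2 Dc.
have [abN | nabN] := boolP (abelian N).
  by exists 1%N; rewrite (center_idP abN) indexgg.
have [x Nx [y Ny nt_xy]] : exists2 x, x \in N & exists2 y, y \in N & [~ x, y] != 1.
  case/subsetPn: nabN => x Nx /centP ncx; exists x => //.
  apply/exists_inP; apply: contraT; rewrite negb_exists_in => /forall_inP no.
  by case: ncx => y Ny; apply/commgP; have := no y Ny; rewrite negbK.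
have comN a b : a \in N -> b \in N -> commute b [~ a, b].
  move=> Na Nb; have /setIP[_ /centP cz] : [~ a, b] \in 'Z(N) by rewrite (subsetP cl2) ?mem_commg.
  by apply: commute_sym; apply: cz.
have [cl_x card_x] := class_prime_commutators prD (fun h Nh => Dc x h Nx Nh) Ny nt_xy (comN _ _ Nx Ny).
pose C := 'C_N[x]%G; have sCN : C \subset N by apply: subsetIl.
have Cx : x \in C by rewrite inE Nx cent1id.
have nt_yx : [~ y, x] != 1 by rewrite commg1_sym.
have DcC h : h \in C -> [~ y, h] \in D by move=> Ch; rewrite Dc // (subsetP sCN).
have [cl_y card_y] := class_prime_commutators prD DcC Cx nt_yx (comN _ _ Ny Nx).
pose N1 := 'C_C[y]%G; have sN1C : N1 \subset C by apply: subsetIl.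
have sN1N := subset_trans sN1C sCN.
have ZN1 : 'Z(N1) = 'Z(N).
  apply/eqP; rewrite eqEsubset; apply/andP; split; last first.
    rewrite subsetI; apply/andP; split; last first.
      by apply: subset_trans (subsetIr _ _) (centS sN1N).
    apply/subsetP=> z /setIP[Nz /centP cz].
    by apply/setIP; split; [apply/setIP; split=> // |]; apply/cent1P; apply: cz.
  apply/subsetP=> z /setIP[N1z /centP cz]; rewrite inE (subsetP sN1N) //=.
  have [[_ /cent1P czx] /cent1P czy] : (z \in N /\ z \in 'C[x]) /\ z \in 'C[y].
    by case/setIP: N1z => /setIP.
  (* Corrected by powers of [y] and then [x], [n] becomes an element [t] of [N1]. *)
  apply/centP=> n Nn.
  have : x ^ n \in x ^: <[y]> by rewrite -cl_x memJ_class.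
  case/imsetP=> _ /cycleP[j ->] xn.
  pose w := n * y ^- j; have Cw : w \in C.
    rewrite inE groupM ?groupV ?groupX //=; apply/cent1P/commute_sym/commgP/conjg_fixP.
    by rewrite conjgM xn -conjgM mulgV conjg1.
  have : y ^ w \in y ^: <[x]> by rewrite -cl_y memJ_class.
  case/imsetP=> _ /cycleP[i ->] yw.
  pose t := w * x ^- i; have N1t : t \in N1.
    rewrite inE groupM ?groupV ?groupX //=; apply/cent1P/commute_sym/commgP/conjg_fixP.
    by rewrite conjgM yw -conjgM mulgV conjg1.
  have -> : n = t * x ^+ i * y ^+ j by rewrite /t /w !mulgKV.
  by apply: commuteM; [apply: commuteM; [apply: cz | ] | ]; try apply: commuteX.
have prD1 := prime_gt1 prD.
have idx : #|N : N1| = (#|D| ^ 2)%N.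
  by rewrite -(Lagrange_index sCN sN1C) /= !index_cent1 card_x card_y.
have lt_k : #|N1| < k.
  apply: leq_trans le_k; rewrite -(Lagrange sN1N) idx.
  by rewrite ltn_Pmulr ?cardG_gt0 // (ltn_trans prD1) // -{1}(expn1 #|D|) ltn_exp2l.
have [] := IHk N1 lt_k.
- by rewrite ZN1; apply: subset_trans cl2; apply: commgSS.
- by move=> a b N1a N1b; apply: Dc; apply: (subsetP sN1N).
move=> s idx1; exists (#|D| * s)%N.
have sZN1 : 'Z(N) \subset N1 by rewrite -ZN1 center_sub.
by rewrite -(Lagrange_index sN1N sZN1) idx /= -ZN1 idx1 expnMn.
Qed.

End SquareIndex.

(** * Normal structure of a solvable group containing an element of primitive prime order *)

Section Dichotomy.
Local Open Scope group_scope.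
Variables (gT : finGroupType) (G : {group gT}).

(** [A] centralises [N / [~: N, A]], and under coprime action the fixed points of a quotient
    lift. *)
Lemma coprime_comm_cent_mulG (N A : {group gT}) :
    A \subset 'N(N) -> coprime #|N| #|A| -> solvable N ->
  N \subset [~: N, A] * 'C_N(A).
Proof.
move=> nNA coNA solN; have sRN : [~: N, A] \subset N by rewrite commg_subl.
have nRN : N \subset 'N([~: N, A]) by rewrite commg_norml.
have nRA : A \subset 'N([~: N, A]) by rewrite commg_normr.
rewrite -quotientSK //= (coprime_quotient_cent sRN nRA coNA solN).
by rewrite subsetI subxx /= quotient_cents2r.
Qed.

Lemma conj_cent_cycle (g h : gT) :
    cyclic 'C_G[g] -> g \in G -> h \in G -> g ^ h \in 'C[g] -> g ^ h \in <[g]>.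
Proof.
move=> cycC Gg Gh cgh; have Cgh : g ^ h \in 'C_G[g] by rewrite inE groupJ.
have Cg : g \in 'C_G[g] by rewrite inE Gg cent1id.
suff /eqP <- : <[g ^ h]> == <[g]> by apply: cycle_id.
by rewrite (eq_subG_cyclic cycC) ?cycle_subG // -!orderE orderJ.
Qed.

(** [g ^ n] centralises [g], so it lies in [<[g]>]. The commutator is then in [<[g]>], of order [p],
    and in [M], of order prime to [p]. *)
Lemma comm_cent_in_cycle (g n : gT) p (M : {group gT}) :
    cyclic 'C_G[g] -> g \in G -> n \in G -> #[g] = p -> prime p -> ~~ (p %| #|M|) ->
    [~ n, g] \in M -> [~ n, g] \in 'C[g] ->
  [~ n, g] = 1.
Proof.
move=> cycC Gg Gn og p_pr ndvd Mng cng.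
have gng : [~ n, g] \in <[g]>.
  have gn : g ^ n \in <[g]>.
    apply: conj_cent_cycle => //; rewrite conjg_mulR groupM ?cent1id //.
    by rewrite -[[~ g, n]]invg_comm groupV.
  by rewrite -invg_comm groupV commgEl groupM ?groupV ?cycle_id.
apply/eqP; apply: contraR ndvd => nt; rewrite -og.
have : #[ [~ n, g] ] %| p by rewrite -og order_dvdG.
case/primeP: (p_pr) => _ /[apply]; rewrite order_eq1 (negbTE nt) og /= => /eqP <-.
exact: order_dvdG.
Qed.

Theorem solvable_irr_dichotomy (F : finFieldType) n (rG : mx_representation F G n)
    (g : gT) p :
    mx_faithful rG -> solvable G -> g \in G -> #[g] = p ->
    primitive_divisor p #|F| n -> (1 < n)%N ->
  <[g]> <| G \/
  exists N : {group gT}, [/\ N <| G, 2.-abelem (N / 'Z(N)), #|N : 'Z(N)| = (n ^ 2)%N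
    & {in 'Z(N), forall z, is_scalar_mx (rG z)}].
Proof.
move=> fG solG Gg og ppd n_gt1; have [p_pr _ _] := ppd; have n_gt0 := ltnW n_gt1.
(* By primitivity the order of [#|F|] modulo [p] is at least [n], and it is less than [p]. *)
have lt_np : (n < p)%N.
  have co_qp := primitive_divisor_coprime n_gt0 ppd.
  have [d /andP[d_gt0 lt_dp] dP] := exp_mod_order p_pr co_qp.
  apply: leq_ltn_trans lt_dp; rewrite leqNgt; apply/negP=> lt_dn.
  have [_ _ /(_ d)] := ppd; rewrite d_gt0 lt_dn => /(_ isT).
  by rewrite dvdn_pred_exp ?dP ?dvdnn // ltnW ?finNzRing_gt1.
have sgG : <[g]> \subset G by rewrite cycle_subG.
have irrg (sXG : <[g]> \subset G) : mx_irreducible (subg_repr rG sXG).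
  by apply: (prime_order_mx_irr ppd n_gt0); rewrite ?og //; apply: subg_mx_faithful.
have cycC : cyclic 'C_G[g].
  by rewrite -cent_cycle; apply: (cent_irr_cyclic fG (irrg sgG)) (cycle_abelian g).
have Cg : g \in 'C_G[g] by rewrite inE Gg cent1id.
have abC := cyclic_abelian cycC.
have [cGg | ncGg] := boolP (G \subset 'C[g]).
  left; rewrite /normal sgG (subset_trans cGg) // -cent_cycle cent_sub //.
have [N /mingroupP[/andP[nsNG ncNg] minN] sNG] :=
  @mingroup_exists _ (fun N : {group gT} => (N <| G) && ~~ (N \subset 'C[g])) G
    (introT andP (conj (normal_refl G) ncGg)).
have nNG := normal_norm nsNG; have nNg : g \in 'N(N) by apply: (subsetP nNG).
(* The largest normal subgroup of [G] inside ['C_N[g]]; by minimality of [N] it contains every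
   normal subgroup of [G] properly inside [N]. *)
pose M := gcore_group 'C_N[g] G.
have sMC : M \subset 'C_N[g] by apply: gcore_sub.
have sMN : M \subset N := subset_trans sMC (subsetIl _ _).
have cMg : M \subset 'C[g] := subset_trans sMC (subsetIr _ _).
have sMG := subset_trans sMN sNG.
have nMG : G \subset 'N(M) by apply: gcore_norm.
have nsMG : M <| G by rewrite /normal sMG.
have properM (K : {group gT}) : K <| G -> K \subset N -> K :!=: N -> K \subset M.
  move=> nsKG sKN neKN; apply: gcore_max; last exact: normal_norm.
  rewrite subsetI sKN; apply: contraR neKN => ncK; apply/eqP.
  by apply: minN; rewrite ?nsKG.
have prMN : M \proper N.
  by rewrite properE sMN; apply: contra ncNg => /subset_trans; apply.
(* If [p] divides [#|M|], then [<[g]>] is the only subgroup of order [p] in the cyclic group [M],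
   hence characteristic in it. *)
have [pM | p'M] := boolP (p %| #|M|).
  left; have [z Mz oz] := Cauchy p_pr pM.
  have sMCG : M \subset 'C_G[g] by rewrite subsetI sMG.
  have sgM : <[g]> \subset M.
    have /eqP <- : <[z]> == <[g]>.
      by rewrite (eq_subG_cyclic cycC) ?cycle_subG // ?(subsetP sMCG) // -!orderE oz og.
    by rewrite cycle_subG.
  by apply: char_normal_trans nsMG; rewrite (sub_cyclic_char _ (cyclicS sMCG cycC)).
right.
have fixcomm m : m \in N -> [~ m, g] \in M -> m \in 'C[g].
  move=> Nm Mmg; apply/cent1P/commgP/eqP.
  apply: (comm_cent_in_cycle cycC Gg (subsetP sNG m Nm) og p_pr p'M Mmg).
  exact: (subsetP cMg).
(* If not, ['C_N(M)] lies in [M]. As [g] centralises [M], every [[~ m, g]] with [m] in [N] lies in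
   ['C_N(M)], and [fixcomm] makes [g] centralise [N]. *)
have cNM : N \subset 'C(M).
  have nsK : 'C_N(M) <| G.
    rewrite /normal subIset ?sNG //=; apply: normsI => //.
    exact: subset_trans nMG (cent_norm M).
  have [/setIidPl // | neK] := eqVneq 'C_N(M) N.
  have sKM : 'C_N(M) \subset M by apply: properM; rewrite ?subsetIl.
  case/negP: ncNg; apply/subsetP=> m Nm; apply: fixcomm => //.
  have Gm := subsetP sNG m Nm.
  apply: (subsetP sKM); rewrite inE; apply/andP; split.
    by rewrite commgEl groupM ?groupV // memJ_norm.
  apply/centP=> x Mx; apply/commute_sym/commgP/conjg_fixP.
  have cMJ y : y \in M -> y ^ g = y.
    by move=> My; apply/conjg_fixP/commgP/cent1P; apply: (subsetP cMg).
  have cMJV y : y \in M -> y ^ g^-1 = y by move=> /cMJ {1}<-; rewrite conjgK.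
  have Mxm : x ^ m^-1 \in M by rewrite memJ_norm // groupV (subsetP nMG).
  by rewrite commgEl (conjgE m g) !conjgM (cMJV _ Mxm) conjgKV cMJ.
have nsZG : 'Z(N) <| G by apply: gFnormal_trans.
have [defZ | neZ] := eqVneq 'Z(N) N.
  case/negP: ncNg; apply: (abelian_normalised_cent fG) og p_pr lt_np irrg => //.
  by apply/center_idP.
have defZ : 'Z(N) = M.
  apply/eqP; rewrite eqEsubset properM ?center_sub //= subsetI sMN.
  by rewrite centsC cNM.
have solN := solvableS sNG solG.
have ntN : N :!=: 1 by apply: contraNneq ncNg => ->; rewrite sub1G.
have der1 : [~: N, N] \subset M.
  apply: (properM N^`(1)%G); rewrite ?der_sub //; first exact: gFnormal_trans.
  by rewrite proper_neq // (sol_der1_proper solN).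
have nNM : N \subset 'N(M) := subset_trans sNG nMG.
have [r r_pr abr] : exists2 r, prime r & r.-abelem (N / M).
  apply/is_abelemP.
  have chf : chief_factor G M N.
    rewrite /chief_factor nsNG andbT; apply/maxgroupP; split; first by rewrite prMN.
    move=> H /andP[/properP[sHN [x Nx nHx]] nHG] sMH.
    apply/eqP; rewrite eqEsubset sMH andbT; apply: properM => //.
      by rewrite /normal nHG (subset_trans sHN).
    by apply: contraNneq nHx => ->.
  have [] // := minnormal_solvable (chief_factor_minnormal chf) (subxx _) _.
  exact: quotient_sol.
have cl2 : [~: N, N] \subset 'Z(N) by rewrite defZ.
(* [x ^+ r] lies in [M], which [N] centralises, and [[~ x, y] ^+ r = [~ x ^+ r, y]]. *)
have comMr x y : x \in N -> y \in N -> [~ x, y] ^+ r = 1 /\ [~ x, y] \in M.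
  move=> Nx Ny; have Mxy : [~ x, y] \in M by rewrite (subsetP der1) ?mem_commg.
  split=> //; rewrite -commXg; last first.
    exact: (centP (subsetP cNM x Nx)).
  apply/eqP/commgP/commute_sym; have /(abelemP r_pr)[_ expr1] := abr.
  have: x ^+ r \in M.
    apply: coset_idr; first by rewrite (subsetP nNM) ?groupX.
    by rewrite morphX ?(subsetP nNM) // expr1 // mem_quotient.
  by apply: (centP (subsetP cNM y Ny)).
have [x0 N0 [y0 Ny0 nt_c]] : exists2 x, x \in N & exists2 y, y \in N & [~ x, y] != 1.
  have : ~~ abelian N by apply: contra neZ => /center_idP ->.
  case/subsetPn=> x Nx /centP ncx; exists x => //.
  apply/exists_inP; apply: contraT; rewrite negb_exists_in => /forall_inP no.
  by case: ncx => y Ny; apply/commgP; have := no y Ny; rewrite negbK.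
have sMCG : M \subset 'C_G[g] by rewrite subsetI sMG.
have cycM := cyclicS sMCG cycC.
have [cr Mc] := comMr _ _ N0 Ny0.
have ord_r d : d ^+ r = 1 -> d != 1 -> #[d] = r.
  move=> dr nt; have : #[d] %| r by rewrite order_dvdn dr.
  by case/primeP: (r_pr) => _ /[apply]; rewrite order_eq1 (negbTE nt) => /eqP.
have oc : #[[~ x0, y0]] = r by apply: ord_r.
have ne_rp : r != p by apply: contraNneq p'M => <-; rewrite -oc order_dvdG.
(* The nontrivial commutators all have order [r] in the cyclic group [M], so they lie in one
   subgroup of order [r]. *)
have [s idxN] : exists s, #|N : 'Z(N)| = (s ^ 2)%N.
  apply: (@center_index_square _ N <[[~ x0, y0]]>%G) => //; first by rewrite -orderE oc.
  move=> x y Nx Ny; have [dr Md] := comMr x y Nx Ny.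
  have [-> | nt_d] := eqVneq [~ x, y] 1; first exact: group1.
  rewrite /=; suff /eqP <- : <[[~ x, y]]> == <[[~ x0, y0]]> by apply: cycle_id.
  by rewrite (eq_subG_cyclic cycM) ?cycle_subG // -!orderE oc ord_r.
have rNM : r.-group (N / M) := abelem_pgroup abr.
have idxM : #|N / M| = (s ^ 2)%N by rewrite card_quotient // -idxN defZ.
have coN : coprime #|N| #|<[g]>|.
  rewrite -orderE og coprime_sym prime_coprime //.
  rewrite -(Lagrange sMN) Euclid_dvdM // negb_or p'M -(card_quotient nNM).
  have [k ->] := p_natP rNM; apply: contra ne_rp.
  by rewrite Euclid_dvdX // dvdn_prime2 // eq_sym; case/andP.
have nNgC : <[g]> \subset 'N(N) by rewrite cycle_subG.
have nMgC : <[g]> \subset 'N(M) by apply: subset_trans nMG.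
(* By the three subgroup lemma [[~: N, <[g]>]] centralises ['C_N(<[g]>)], which is itself abelian;
   by coprimality [N] is the product of the two. *)
have sCM : 'C_N(<[g]>) \subset M.
  have sCC : 'C_N(<[g]>) \subset 'C_G[g] by rewrite cent_cycle setSI.
  rewrite -defZ subsetI subsetIl /=.
  have cRC : [~: N, <[g]>, 'C_N(<[g]>)] = 1.
    apply: three_subgroup.
      have /commG1P -> : <[g]> \subset 'C('C_N(<[g]>)) by rewrite centsC subsetIr.
      exact: comm1G.
    apply/commG1P; rewrite cent_cycle; apply: subset_trans cMg.
    by apply: subset_trans der1; apply: commSg; apply: subsetIl.
  rewrite centsC; apply: subset_trans (coprime_comm_cent_mulG nNgC coN solN) _.
  rewrite mul_subG //; first by apply/commG1P.
  exact: abelianS sCC abC.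
(* [g] fixes only the identity of [N / M], by [sCM] and coprimality. *)
have p_dvd : p %| (s ^ 2).-1.
  have pgM : p.-group (<[g]> / M) by apply: quotient_pgroup; rewrite /pgroup -orderE og pnat_id.
  have nq : [acts <[g]> / M, on N / M | 'J] by rewrite astabsJ quotient_norms.
  have := pgroup_fix_mod pgM nq; rewrite afixJ.
  rewrite -(coprime_quotient_cent sMN nMgC coN solN) idxM.
  rewrite (trivgP _ : 'C_N(<[g]>) / M = 1) ?cards1; last by rewrite quotient_sub1 // (subset_trans sCM).
  move/eqP; rewrite eqn_mod_dvd ?subn1 // -idxM cardG_gt0 //.
have cgZ : 'Z(N) \subset 'C(<[g]>) by rewrite defZ cent_cycle.
have [le_idx abs_irr] := center_index_leq sNG fG (irrg sgG) cl2 cgZ.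
have le_sn : (s <= n)%N by rewrite -(@leq_exp2r _ _ 2) // -idxN.
have s_gt1 : (1 < s)%N.
  have : (1 < s ^ 2)%N by rewrite -idxN defZ indexg_gt1 proper_subn.
  by case: (s) => [|[|]].
(* As [0 < s - 1 < p], [p] divides [s + 1]; with [s <= n < p] this leaves only [s = n] and
   [p = n + 1]. *)
move: p_dvd; rewrite -subn1 -[X in (_ - X)%N](exp1n 2) subn_sqr subn1 addn1.
have lt_s1p : (s.-1 < p)%N by apply: leq_trans lt_np; rewrite ltnW // prednK // ltnW.
rewrite Euclid_dvdM // gtnNdvd //=; last by rewrite -ltnS prednK // ltnW.
move=> /dvdn_leq-/(_ isT) le_ps.
have def_s : s = n by apply/eqP; rewrite eqn_leq le_sn -ltnS (leq_trans lt_np).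
have def_p : p = n.+1 by apply/eqP; rewrite eqn_leq lt_np -def_s le_ps.
(* [p = n + 1 > 2] is odd, so 2 divides [n ^ 2], the order of the [r]-group [N / M]. *)
have r2 : r = 2%N.
  have := pgroupP rNM 2 isT; rewrite idxM def_s Euclid_dvdX //= dvdn2.
  have [p2|] := even_prime p_pr; first by move: n_gt1; rewrite -ltnS -def_p p2.
  by rewrite def_p /= => -> /(_ isT)/eqP.
exists N; split=> //; first by rewrite defZ -r2.
  by rewrite idxN def_s.
move=> z Zz; have Nz := subsetP (center_sub N) z Zz.
have idxNn : #|N : 'Z(N)| = (n ^ 2)%N by rewrite idxN def_s.
apply: (mx_abs_irr_cent_scalar (abs_irr idxNn)).
apply/centgmxP=> y Ny /=; have cyz : (z * y = y * z)%g by have /setIP[_ /centP] := Zz; apply.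
by rewrite -!repr_mxM ?(subsetP sNG) // cyz.
Qed.

End Dichotomy.

Local Open Scope ring_scope.

(** * Symplectic spreads *)

Section SymplecticRepr.
Variables (F : finFieldType) (V : vectType F) (f : {skew_symmetric V}).
Local Notation fV := (finvect_type V).
Local Notation n := (dim V).

(** The matrix acts on row vectors from the right, which matches the left-to-right product of
    permutations; it represents [s] when [s] is linear. *)
Definition perm_mx_of (s : {perm fV}) : 'M[F]_n :=
  lin1_mx (fun u : 'rV[F]_n => v2r (s (r2v u : V) : V)).

Lemma Sp_linear s : s \in Sp f -> linear (s : V -> V).
Proof. by case/SpP. Qed.

Lemma v2r_perm_mx (s : {perm fV}) (v : V) : s \in Sp f ->
  v2r (s v : V) = v2r v *m perm_mx_of s.
Proof.
move=> Sps; pose mix := GRing.isLinear.Build F V V *:%R (s : V -> V) (Sp_linear Sps).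
pose sL : {linear V -> V} := HB.pack (s : V -> V) mix.
have -> : perm_mx_of s = lin1_mx (v2r \o sL \o r2v) by [].
by rewrite mul_rV_lin1 /= v2rK.
Qed.

Lemma perm_mx_of_repr : mx_repr (Sp f) perm_mx_of.
Proof.
split=> [|s t Sps Spt].
  apply/row_matrixP=> i; rewrite !rowE -[delta_mx 0 i]r2vK -v2r_perm_mx ?group1 //.
  by rewrite perm1 mulmx1.
apply/row_matrixP=> i; rewrite !rowE -[delta_mx 0 i]r2vK mulmxA.
by rewrite -!v2r_perm_mx ?permM // groupM.
Qed.
Canonical Sp_repr := MxRepresentation perm_mx_of_repr.

(** Turns a relation between matrices into one between vectors, to which [f] can be applied. *)
Lemma Sp_sum (c : {perm fV}) (X : {set {perm fV}}) (y : {perm fV} -> {perm fV})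
    (a : {perm fV} -> F) (v : V) :
  c \in Sp f -> {in X, forall x, y x \in Sp f} ->
  Sp_repr c = \sum_(x in X) a x *: Sp_repr (y x) ->
  c v = \sum_(x in X) a x *: (y x v : V) :> V.
Proof.
move=> Sc Sy cE; apply: v2r_inj; rewrite (v2r_perm_mx v Sc) [perm_mx_of c]cE.
rewrite mulmx_sumr linear_sum; apply: eq_bigr => x Xx.
by rewrite -scalemxAr [RHS]linearZ /= (v2r_perm_mx v (Sy x Xx)).
Qed.

Lemma Sp_linear0 s : s \in Sp f -> s (0 : V) = 0 :> V.
Proof.
move=> /Sp_linear slin; have := slin 1 0 0; rewrite scaler0 addr0 scale1r.
by move=> /(congr1 (fun w : V => w - s (0 : V))); rewrite addrK subrr => <-.
Qed.

Lemma Sp_repr_faithful : mx_faithful Sp_repr.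
Proof.
apply/subsetP=> s; rewrite inE mul1mx => /andP[Sps /eqP s1]; apply/set1P/permP=> v.
by rewrite perm1; apply: v2r_inj; rewrite v2r_perm_mx // [perm_mx_of s]s1 mulmx1.
Qed.

Lemma Sp_scalar s a (v : V) : s \in Sp f -> Sp_repr s = a%:M -> s v = a *: v :> V.
Proof.
by move=> Sps sa; apply: v2r_inj; rewrite v2r_perm_mx // [perm_mx_of s]sa mul_mx_scalar linearZ.
Qed.

Lemma Sp_scalarP s a : s \in Sp f -> (forall v : V, s v = a *: v :> V) -> Sp_repr s = a%:M.
Proof.
move=> Sps sa; apply/row_matrixP=> i; rewrite !rowE -[delta_mx 0 i]r2vK.
by rewrite -[LHS]v2r_perm_mx // sa linearZ mul_mx_scalar.
Qed.

Lemma Sp_form s (u v : V) : s \in Sp f -> f (s u : V) (s v : V) = f u v.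
Proof. by case/SpP=> _ ->. Qed.

Hypothesis ndf : nondegenerate f.

Lemma nondegenerate_eq0 (u : V) : (forall v, f u v = 0) -> u = 0.
Proof.
move=> fu0; apply/eqP; have /eqP rad0 := ndf; rewrite -memv0 -rad0.
by apply/mem_orthovP=> v _; apply: fu0.
Qed.

(** Multiplication by [a] scales [f] by [a ^+ 2], and some value of [f] is nonzero. *)
Lemma Sp_scalar_sqr s a : (0 < n)%N -> s \in Sp f -> Sp_repr s = a%:M -> a ^+ 2 = 1.
Proof.
move=> n_gt0 Sps sa.
pose u : V := r2v (delta_mx 0 (Ordinal n_gt0)).
have u_nz : u != 0.
  rewrite -(inj_eq (@v2r_inj _ _)) linear0 r2vK.
  by apply/eqP=> /rowP/(_ (Ordinal n_gt0))/eqP; rewrite !mxE !eqxx oner_eq0.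
have /existsP[v fuv] : [exists v : fV, f u (v : V) != 0].
  apply: contraNT u_nz; rewrite negb_exists => /forallP no.
  apply/eqP/nondegenerate_eq0 => v; apply/eqP.
  by have := no v; rewrite negbK.
have := Sp_form u v Sps; rewrite !(Sp_scalar _ Sps sa) linearZl_LR linearZr_LR /=.
rewrite mulrA -expr2 => /(canRL (mulfK fuv)); rewrite divff //.
Qed.

End SymplecticRepr.

(** * Fields of order 1 modulo 4 and counting inequalities *)

Lemma odd_eq1_mod4 k : k = 1 %[mod 4] -> odd k.
Proof. by move=> k1; rewrite -(@odd_mod k 4) // k1. Qed.

Lemma finField_two_neq0 (F : finFieldType) : #|F| = 1 %[mod 4] -> (2%:R : F) != 0.
Proof.
move=> /odd_eq1_mod4 oddF; apply/negP=> /eqP two0.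
have d2 : (#[1%R : F]%g %| 2)%N by rewrite order_dvdn FinRing.zmodXgE two0.
have dF : (#[1%R : F]%g %| #|F|)%N by rewrite -cardsT order_dvdG ?inE.
have : (#[1%R : F]%g %| gcdn #|F| 2)%N by rewrite dvdn_gcd dF.
have /eqP -> : coprime #|F| 2 by rewrite coprimen2.
by rewrite dvdn1 order_eq1 -[1%g]/(0%R) oner_eq0.
Qed.

Lemma card_ge5_eq1_mod4 (F : finFieldType) : #|F| = 1 %[mod 4] -> (5 <= #|F|)%N.
Proof. by have := finNzRing_gt1 F; case: #|F| => [|[|[|[|[|k]]]]]. Qed.

(** [i] is an element of order 4 in the unit group, which is cyclic of order divisible by 4. *)
Lemma finField_sqrtN1 (F : finFieldType) : #|F| = 1 %[mod 4] ->
  exists i : F, i ^+ 2 = -1.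
Proof.
move=> /eqP F1; have q_gt1 := finNzRing_gt1 F.
have dv4 : (4 %| #|F|.-1)%N by rewrite -subn1 -eqn_mod_dvd // ltnW.
have /cyclicP[g defg] := field_unit_group_cyclic [set: {unit F}].
have og : #[g]%g = #|F|.-1 by rewrite orderE -defg card_finField_unit.
pose u := (g ^+ (#|F|.-1 %/ 4))%g.
have pos : (0 < #|F|.-1)%N by rewrite -ltnS prednK // ltnW.
have ou : #[u]%g = 4%N by rewrite orderXdiv og ?dvdn_div // divnA // mulKn.
exists (val u).
have u4 : (val u ^+ 2) ^+ 2 = 1.
  by rewrite -exprM -FinRing.val_unitX -[(2 * 2)%N]ou expg_order.
have u2 : val u ^+ 2 != 1.
  rewrite -FinRing.val_unitX -(FinRing.val_unit1 F) (inj_eq val_inj) -order_dvdn ou //.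
by move/eqP: u4; rewrite sqrf_eq1 (negbTE u2) => /eqP.
Qed.

Lemma card_finvect_vspace (F : finFieldType) (V : vectType F) (W : {vspace V}) :
  #|[set v : finvect_type V | (v : V) \in W]| = (#|F| ^ \dim W)%N.
Proof.
case: V W => T cT W; rewrite -(@card_vspace F (finvect_type (Vector.Pack cT)) cT W).
by apply: eq_card => v; rewrite inE.
Qed.

(** [Q] stands for [q ^ m], [p] for [q - 1] and [t] for the number of members fixed by an
    element. *)
Lemma fixed_count_arith (Q t p : nat) :
  (0 < Q -> 4 <= p -> t * p <= Q.-1 + p -> 4 * t <= Q + 3)%N.
Proof.
case: t => [|t] Q_gt0 p_ge4; first by lia.
rewrite mulSn => le_t; have : (t * 4 <= t * p)%N by rewrite leq_mul2l p_ge4 orbT.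
by lia.
Qed.

(** [z] and [R] stand for the order and the index of ['Z(N)], [Q] for [q ^ m], and [P] for the
    number of pairs of a noncentral element and a member that it fixes. The two bounds yield
    [Q * R <= R + 3 * Q + 1]. *)
Lemma double_count_arith (z R Q P : nat) :
  (0 < z -> 16 <= R -> 25 <= Q -> 4 * P <= (z * R - z) * (Q + 3) ->
   (Q + 1) * (z * R) <= 2 * P + 2 * z * (Q + 1) -> False)%N.
Proof.
move=> z_gt0 R_ge Q_ge leP geP.
have leP' : (4 * P <= z * ((R - 1) * (Q + 3)))%N.
  by apply: leq_trans leP _; rewrite mulnA mulnBr muln1.
have : (z * (2 * ((Q + 1) * R)) <= z * ((R - 1) * (Q + 3) + 4 * (Q + 1)))%N.
  rewrite mulnDr; move: leP'; set X := (z * (_ * _))%N => leP'.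
  have -> : (z * (2 * ((Q + 1) * R)) = 2 * ((Q + 1) * (z * R)))%N by lia.
  have -> : (z * (4 * (Q + 1)) = 2 * (2 * z * (Q + 1)))%N by lia.
  move: geP leP'; set Y := ((Q + 1) * _)%N; set Z := (2 * z * _)%N; lia.
rewrite leq_pmul2l // -(subnKC R_ge) -(subnKC Q_ge).
move: (R - 16)%N (Q - 25)%N => r s.
by rewrite (_ : 16 + r - 1 = 15 + r)%N; lia.
Qed.

(** * Members of a spread fixed by elements with scalar square *)

Section Spread.
Variables (F : finFieldType) (V : vectType F) (f : {skew_symmetric V}).
Local Notation fV := (finvect_type V).
Variables (m : nat) (Omega : {set {set fV}}).
Hypothesis dimV : \dim {: V} = (2 * m)%N.
Hypothesis spread : complete_symplectic_spread f m Omega.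
Local Notation q := #|F|.

Lemma card_spread : #|Omega| = (q ^ m + 1)%N. Proof. by case: spread. Qed.

Lemma spread_linear A a (u v : V) : A \in Omega ->
  (u : fV) \in A -> (v : fV) \in A -> (a *: u + v : fV) \in A.
Proof.
by case: spread => _ subs _ _ /subs[W [-> _ _]]; rewrite !inE => Wu Wv; rewrite memvD ?memvZ.
Qed.

Lemma spread_mem0 A : A \in Omega -> (0 : fV) \in A.
Proof. by case: spread => _ subs _ _ /subs[W [-> _ _]]; rewrite inE mem0v. Qed.

Lemma spread_scale A a (u : V) : A \in Omega -> (u : fV) \in A -> (a *: u : fV) \in A.
Proof.
by move=> OA Au; rewrite -[_ *: _]addr0; apply: (@spread_linear A a u 0) => //; apply: spread_mem0.
Qed.

Lemma spread_isotropic A (u v : V) : A \in Omega ->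
  (u : fV) \in A -> (v : fV) \in A -> f u v = 0.
Proof. by case: spread => _ subs _ _ /subs[W [-> _ iso]]; rewrite !inE; apply: iso. Qed.

Lemma card_spread_mem A : A \in Omega -> #|A| = (q ^ m)%N.
Proof.
case: spread => _ subs _ _ /subs[W [-> <- _]].
exact: card_finvect_vspace.
Qed.

Lemma card_space : #|fV| = (q ^ (2 * m))%N.
Proof. rewrite -dimV -card_finvect_vspace -cardsT.
by apply: eq_card => v; rewrite !inE memvf. Qed.

Lemma spread_eq A B (v : fV) : A \in Omega -> B \in Omega ->
  v != 0 -> v \in A -> v \in B -> A = B.
Proof.
case: spread => _ _ _ triv OA OB nz Av Bv; apply/eqP; apply: contraT => /(triv _ _ OA OB).
by move/setP/(_ v); rewrite !inE Av Bv (negbTE nz).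
Qed.

Lemma spread_cover (v : fV) : exists2 A, A \in Omega & v \in A.
Proof.
case: spread => _ _ cov _; have : v \in cover Omega by rewrite cov inE.
by case/bigcupP=> A; exists A.
Qed.

(** Distinct members share only 0, so each nonzero vector of [E] is counted at most once. *)
Lemma spread_disjoint_sum (S : {set {set fV}}) (E : {set fV}) : S \subset Omega ->
  (\sum_(A in S) #|(A :&: E) :\ 0%R| <= #|E :\ 0%R|)%N.
Proof.
move=> sSO; rewrite -sum1_card.
rewrite (eq_bigr (fun A : {set fV} => \sum_(v in E :\ 0%R) (v \in A)))%N; last first.
  move=> A _; rewrite -sum1_card big_mkcond [RHS]big_mkcond /=; apply: eq_bigr => v _.
  by rewrite !inE; case: (v \in A); case: (v \in E); case: (v == 0).
rewrite exchange_big /=; apply: leq_sum => v /setD1P[nz _].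
rewrite -big_mkcondr sum1_card /=; apply/card_le1_eqP => A B /andP[SA vA] /andP[SB vB].
by apply: (spread_eq _ _ nz); rewrite ?(subsetP sSO).
Qed.

Definition eigenset (x : {perm fV}) (a : F) := [set v : fV | (x v : V) == a *: (v : V)].

Lemma eigenset_fix (x : {perm fV}) (a : F) A (v : fV) : a != 0 -> A \in Omega -> x @: A \in Omega ->
  v \in eigenset x a -> v != 0 -> v \in A -> x @: A = A.
Proof.
move=> nza OA OxA; rewrite inE => /eqP xv nzv Av; apply: (@spread_eq _ _ (x v)) => //.
- by rewrite xv scaler_eq0 negb_or nza.
- exact: imset_f.
by rewrite xv; apply: spread_scale.
Qed.

Lemma eigenset_linear (x : {perm fV}) (a c : F) (u v : V) : x \in Sp f ->
  (u : fV) \in eigenset x a -> (v : fV) \in eigenset x a -> (c *: u + v : fV) \in eigenset x a.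
Proof.
move=> /Sp_linear xlin; rewrite !inE => /eqP xu /eqP xv.
by rewrite xlin xu xv scalerDr !scalerA mulrC.
Qed.

Lemma eigenset_mem0 (x : {perm fV}) (a : F) : x \in Sp f -> (0 : fV) \in eigenset x a.
Proof.
by move=> Sx; rewrite inE scaler0 (Sp_linear0 Sx).
Qed.

(** [V] is the direct sum of the two eigenspaces. The two inequalities come from the injections
    sending [(u, v)] to [u + v] and [v] to [(x v + a v, x v - a v)]. *)
Lemma card_eigenset_opp (x : {perm fV}) (a : F) : (2%:R : F) != 0 -> a != 0 -> x \in Sp f ->
    (forall v : V, x (x v) = a ^+ 2 *: v :> V) ->
  (#|eigenset x a| * #|eigenset x (- a)|)%N = (q ^ (2 * m))%N.
Proof.
move=> nz2 nza Sx xx; have xlin := Sp_linear Sx; rewrite -card_space -cardsX.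
have xD (u v : V) : x (u + v) = (x u : V) + (x v : V) :> V by rewrite -[u]scale1r xlin !scale1r.
have xZ c (u : V) : x (c *: u) = c *: (x u : V) :> V.
  have x0 : x (0 : V) = 0 :> V by apply: (addrI (x (0 : V) : V)); rewrite -xD !addr0.
  by rewrite -[c *: u]addr0 xlin x0 addr0.
rewrite -cardsT; apply/eqP; rewrite eqn_leq; apply/andP; split.
  pose h (uv : fV * fV) : fV := (uv.1 : V) + uv.2.
  rewrite -(card_in_imset (f := h)) ?subset_leq_card ?subsetT //.
  move=> [u v] [u' v']; rewrite !inE /= => /andP[/eqP xu /eqP xv] /andP[/eqP xu' /eqP xv'] huv.
  have huv' : (u : V) - v = (u' : V) - v'.
    have := congr1 (fun w : V => x w : V) huv; rewrite /h /= !xD xu xv xu' xv' !scaleNr -!scalerBr.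
    exact: (scalerI nza).
  have eu : (u : V) = u'.
    apply: (scalerI nz2); rewrite !scaler_nat !mulr2n.
    have := congr2 (fun w z : V => w + z) huv huv'; rewrite /h /= addrACA subrr addr0 => ->.
    by rewrite addrACA subrr addr0.
  by move: huv; rewrite /h /= eu => /addrI ->.
pose h (v : fV) : fV * fV := ((x v : V) + a *: (v : V), (x v : V) + (- a) *: (v : V)).
rewrite -(card_in_imset (f := h)); last first.
  move=> u v _ _ huv; have e1 := congr1 (fun w => w.1 : V) huv.
  have e2 := congr1 (fun w => w.2 : V) huv; have {e1 e2} := congr2 (fun w z : V => w - z) e1 e2.
  have subE (p b c : V) : (p + b) - (p + c) = b - c by rewrite opprD addrACA subrr add0r.
  rewrite /h /= !subE -!scaleNr opprK -!scalerDl; apply: scalerI.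
  by rewrite -mulr2n -mulr_natl mulf_neq0.
apply: subset_leq_card; apply/subsetP=> _ /imsetP[v _ ->]; rewrite !inE /=.
have xaE c : c ^+ 2 = a ^+ 2 ->
    x ((x v : V) + c *: (v : V)) = c *: ((x v : V) + c *: (v : V)) :> V.
  by move=> c2; rewrite xD xZ xx scalerDr scalerA -expr2 c2 addrC.
by rewrite !xaE ?sqrrN ?eqxx.
Qed.

(** The scalar [a] is 1 or -1 because [y] preserves [f], and -1 is a square in [F]. *)
Lemma square_scalar_root (x y : {perm fV}) a : nondegenerate f -> (0 < dim V)%N ->
    q = 1 %[mod 4] -> x \in Sp f -> y = (x * x)%g -> Sp_repr f y = a%:M ->
  exists2 c : F, c != 0 & forall v : V, x (x v) = c ^+ 2 *: v :> V.
Proof.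
move=> ndf n_gt0 q1 Sx def_y ya; have Sy : y \in Sp f by rewrite def_y groupM.
have := Sp_scalar_sqr ndf n_gt0 Sy ya; move/eqP; rewrite sqrf_eq1.
have xxE (v : V) : x (x v) = a *: v :> V.
  by have := Sp_scalar v Sy ya; rewrite def_y permM.
case/orP=> /eqP def_a.
  by exists 1; rewrite ?oner_eq0 // => v; rewrite xxE def_a expr1n.
have [i i2] := finField_sqrtN1 q1; exists i; last by move=> v; rewrite xxE def_a i2.
by apply: contra_eq_neq i2 => ->; rewrite expr0n eq_sym oppr_eq0 oner_eq0.
Qed.

Definition fixed_members (x : {perm fV}) := [set A in Omega | x @: A == A].

(** A fixed member either contains a line of the eigenspace [E] for [a], hence [q - 1] of its
    nonzero vectors, or lies in the eigenspace for [- a]. Two members of the second kind would span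
    [V]. *)
Lemma fixed_members_bound (x : {perm fV}) (a : F) : a != 0 -> x \in Sp f ->
    (forall v : V, x (x v) = a ^+ 2 *: v :> V) -> eigenset x (- a) != setT ->
    (#|eigenset x a| <= q ^ m)%N ->
  (#|fixed_members x| * q.-1 <= (q ^ m).-1 + q.-1)%N.
Proof.
move=> nza Sx xx neT leE; set E := eigenset x a in leE *.
pose S0 := [set A in fixed_members x | (A :&: E) :\ 0%R == set0].
have le_S0 : (#|S0| <= 1)%N.
  have subE A : A \in S0 -> {subset A <= eigenset x (- a)}.
    rewrite !inE => /andP[/andP[OA /eqP xA] /eqP/setP AE0] v Av; rewrite inE.
    have Axv : (x v : fV) \in A by rewrite -xA imset_f.
    (* [x] multiplies [w] by [a], so [w] is in [A :&: E], which is 0; hence [x v = - a v]. *)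
    pose w : V := a *: (v : V) + x v; have Aw : (w : fV) \in A by apply: spread_linear.
    have Ew : (w : fV) \in E.
      by rewrite inE /w (Sp_linear Sx) xx scalerDr scalerA -expr2 addrC.
    have w0 : w = 0.
      apply/eqP; apply: contraT => nzw.
      have : (w : fV) \in (A :&: E) :\ 0%R by rewrite in_setD1 nzw in_setI Aw.
      by rewrite AE0 inE.
    by rewrite scaleNr -addr_eq0 addrC -/w w0.
  apply/card_le1_eqP=> A B SA SB; apply/eqP; apply: contraR neT => neAB.
  have [OA OB] : A \in Omega /\ B \in Omega.
    by move: SA SB; rewrite !inE => /andP[/andP[-> _] _] /andP[/andP[-> _] _].
  pose h (uv : fV * fV) : fV := (uv.1 : V) + uv.2.
  have injh : {in setX A B &, injective h}.
    move=> [u v] [u' v']; rewrite !inE /= /h /= => /andP[Au Bv] /andP[Au' Bv'] huv.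
    have dE : (u : V) - u' = (v' : V) - v.
      by apply: (addIr (v : V)); rewrite addrAC huv addrAC subrr add0r subrK.
    have Ad : ((u : V) - u' : fV) \in A.
      by rewrite addrC -scaleN1r; apply: spread_linear.
    have Bd : ((u : V) - u' : fV) \in B.
      by rewrite dE addrC -scaleN1r; apply: spread_linear.
    have [d0 | nzd] := eqVneq ((u : V) - u') 0.
      move: dE; rewrite d0 => /esym/eqP; rewrite subr_eq0 => /eqP ->.
      by move/eqP: d0; rewrite subr_eq0 => /eqP ->.
    by case/eqP: neAB; apply: (spread_eq OB OA nzd Bd Ad).
  have : h @: setX A B = setT.
    apply/eqP; rewrite eqEcard subsetT (card_in_imset injh) cardsT cardsX.
    by rewrite (card_spread_mem OA) (card_spread_mem OB) card_space -expnD addnn -mul2n leqnn.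
  move=> hT; rewrite -subTset -hT; apply/subsetP=> _ /imsetP[[u v] /setXP[/= Au Bv] ->].
  rewrite /h /= -[u]scale1r; apply: eigenset_linear => //; [exact: subE SA _ Au | exact: subE SB _ Bv].
pose S1 := fixed_members x :\: S0.
have S1O : S1 \subset Omega by apply/subsetP=> A; rewrite !inE => /andP[_ /andP[]].
have le_S1 : (#|S1| * q.-1 <= (q ^ m).-1)%N.
  apply: (@leq_trans #|E :\ 0%R|); last first.
    have E0 : (0 : fV) \in E by apply: eigenset_mem0.
    by move: leE; rewrite (cardsD1 (0 : fV) E) E0 add1n => leE; rewrite -ltnS prednK // expn_gt0 ltnW ?finNzRing_gt1.
  apply: leq_trans (spread_disjoint_sum E S1O); rewrite -sum_nat_const.
  apply: leq_sum => A S1A; move: (S1A); rewrite !inE => /andP[nS0 fA]; rewrite fA /= in nS0.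
  have [v] := set0Pn _ nS0; rewrite !inE => /andP[nzv /andP[Av Ev]].
  have OA : A \in Omega by case/andP: fA.
  have injs : injective (fun c : F => c *: (v : V) : fV).
    move=> c d /eqP; rewrite -subr_eq0 -scalerBl scaler_eq0 (negbTE nzv) orbF subr_eq0.
    by move/eqP.
  rewrite -(cardsC1 (0 : F)) -(card_imset _ injs); apply: subset_leq_card.
  apply/subsetP=> _ /imsetP[c nzc ->]; rewrite !inE in nzc.
  rewrite in_setD1 in_setI scaler_eq0 negb_or nzc nzv spread_scale //=.
  rewrite -[c *: _]addr0; apply: eigenset_linear => //; last exact: eigenset_mem0.
  by rewrite inE.
rewrite -(cardsID S0 (fixed_members x)) mulnDl addnC leq_add //.
rewrite -[X in (_ <= X)%N]mul1n leq_mul2r (leq_trans _ le_S0) ?orbT //.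
by apply: subset_leq_card; apply: subsetIr.
Qed.

Lemma setact_perm (x : {perm fV}) (A : {set fV}) : ('P^*)%act A x = x @: A.
Proof. by apply/setP=> v; apply/imsetP/imsetP=> -[u Au ->]; exists u. Qed.

(** Pairs of a noncentral element of [N] and a member that it fixes are counted in two ways: each
    element fixes at most about a quarter of [Omega], but each member is fixed by at least half of
    [N]. *)
Lemma spread_no_extraspecial_normal (G N : {group {perm fV}}) :
    nondegenerate f -> q = 1 %[mod 4] -> (2 <= m)%N ->
    G \subset Sp f -> [transitive G, on Omega | 'P^*] -> N <| G ->
    2.-abelem (N / 'Z(N)) -> #|N : 'Z(N)|%g = ((dim V) ^ 2)%N ->
    {in 'Z(N)%g, forall z, is_scalar_mx (Sp_repr f z)} ->
  False.
Proof.
move=> ndf q1 m_ge2 sGS trG nsNG abN idxN scZ.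
have dimVE : dim V = (2 * m)%N by rewrite -dimV dimvf.
have n_gt0 : (0 < dim V)%N by rewrite dimVE muln_gt0 /=; apply: ltnW.
have [sNG nNG] := andP nsNG; have sNS := subset_trans sNG sGS.
have actO x A : x \in G -> A \in Omega -> x @: A \in Omega.
  move=> Gx OA; rewrite -setact_perm (acts_act _ Gx) //; exact: (atrans_acts trG).
have nz2 := finField_two_neq0 q1.
have q_ge5 := card_ge5_eq1_mod4 q1.
(* [x] has scalar square but is not scalar, being noncentral. Of its two possible eigenvalues, [d]
   is one whose eigenspace has at most [q ^ m] vectors. *)
have fix_le x : x \in N :\: 'Z(N) -> (4 * #|fixed_members x| <= q ^ m + 3)%N.
  case/setDP=> Nx nZx; have Sx := subsetP sNS x Nx.
  have Zxx : (x * x)%g \in 'Z(N)%g.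
    have nZN : N \subset 'N('Z(N)) by apply: gFnorm.
    have /(@abelemP _ 2 _ isT)[_ sq1] := abN; apply: coset_idr; first by rewrite groupM ?(subsetP nZN).
    by rewrite morphM ?(subsetP nZN) // -expg2 sq1 // mem_quotient.
  have /is_scalar_mxP[a xxa] := scZ _ Zxx.
  have [c nzc xxc] := square_scalar_root ndf n_gt0 q1 Sx erefl xxa.
  have not_scalar d : eigenset x d != setT.
    apply: contra nZx => /eqP/setP xd.
    have xs : Sp_repr f x = d%:M.
      by apply: Sp_scalarP => // v; have := xd v; rewrite !inE => /eqP.
    rewrite inE Nx; apply/centP=> y Ny; have Sy := subsetP sNS y Ny.
    apply: (mx_faithful_inj (Sp_repr_faithful f)); rewrite ?groupM //.
    by rewrite !repr_mxM // xs scalar_mxC.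
  have [d [nzd xxd le_d]] : exists d, [/\ d != 0, forall v : V, x (x v) = d ^+ 2 *: v :> V
      & (#|eigenset x d| <= q ^ m)%N].
    have := card_eigenset_opp nz2 nzc Sx xxc.
    have [le_c | gt_c] := leqP #|eigenset x c| (q ^ m); first by exists c.
    rewrite mul2n -addnn expnD => eq_card; exists (- c).
    split; rewrite ?oppr_eq0 ?sqrrN //.
    rewrite leqNgt; apply/negP=> gt_c'; have := ltn_mul gt_c gt_c'.
    by rewrite eq_card ltnn.
  have := fixed_members_bound nzd Sx xxd (not_scalar (- d)) le_d.
  have : (4 <= q.-1)%N by rewrite -ltnS prednK // (leq_trans _ q_ge5).
  have : (0 < q ^ m)%N by rewrite expn_gt0 (leq_trans _ q_ge5).
  by move=> Q_gt0 p_ge4 le_fix; apply: fixed_count_arith le_fix.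
(* The [N]-orbit of [A] has 2-power length, since the scalars in ['Z(N)] fix [A]; as [N] is normal
   in [G], this length divides [q ^ m + 1], which is 2 modulo 4. *)
have stab_ge A : A \in Omega -> (#|N| <= 2 * #|[set x in N | x @: A == A]|)%N.
  move=> OA; pose NA := 'C_N[A | 'P^*]%G.
  have NAE : [set x in N | x @: A == A] = NA.
    by apply/setP=> x; rewrite !inE -setact_perm sub1set inE.
  rewrite NAE -(Lagrange (subsetIl N 'C[A | 'P^*])) mulnC leq_mul2r orbC.
  have ZNA : 'Z(N) \subset NA.
    apply/subsetP=> z Zz; have Nz := subsetP (center_sub N) z Zz.
    rewrite -NAE inE Nz /= eqEcard card_imset ?leqnn ?andbT; last exact: perm_inj.
    apply/subsetP=> _ /imsetP[v Av ->].
    have /is_scalar_mxP[a za] := scZ _ Zz.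
    have Sz := subsetP sNS z Nz; have -> : z v = a *: (v : V) :> V by exact: (@Sp_scalar F V f z a v Sz za).
    exact: spread_scale.
  have NA2 : (2%N).-nat #|N : NA|%g.
    apply: (@pnat_dvd _ #|N : 'Z(N)|%g); first exact: indexgS.
    by rewrite -card_quotient ?gFnorm //; apply: abelem_pgroup.
  have dvdO : (#|N : NA|%g %| q ^ m + 1)%N.
    rewrite -card_spread -(atransP trG A OA) card_orbit /=.
    have -> : 'C_N[A | 'P^*] = N :&: 'C_G[A | 'P^*] by rewrite setIA (setIidPl sNG).
    have sGA := subsetIl G 'C[A | 'P^*]; rewrite indexgI.
    have nNGA : 'C_G[A | 'P^*] \subset 'N(N) := subset_trans sGA nNG.
    have sJG : 'C_G[A | 'P^*] <*> N \subset G by rewrite join_subG sGA.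
    rewrite -(Lagrange_index sJG (joing_subl _ _)) /= norm_joinEl // indexMg.
    exact: dvdn_mull.
  have n4 : ~~ (4 %| q ^ m + 1)%N.
    by rewrite /dvdn -modnDml -modnXm q1 modnXm exp1n.
  have [k def_k] := p_natP NA2; rewrite def_k in dvdO *.
  by move: dvdO; case: k {def_k} => [|[|k]] // /(dvdn_trans (dvdn_exp2l 2 (_ : 2 <= k.+2)%N))-/(_ isT); rewrite (negbTE n4).
pose z := #|'Z(N)%g|; pose Q := (q ^ m)%N; pose R := #|N : 'Z(N)|%g.
have cardN : #|N| = (z * R)%N by rewrite Lagrange ?center_sub.
have cardNZ : (#|N :\: 'Z(N)| = z * R - z)%N.
  by rewrite cardsD (setIidPr (center_sub N)) cardN.
pose P := (\sum_(x in N :\: 'Z(N)) #|fixed_members x|)%N.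
have leP : (4 * P <= (z * R - z) * (Q + 3))%N.
  by rewrite -cardNZ big_distrr -sum_nat_const; apply: leq_sum.
(* [stab_ge] is summed over [Omega]; central elements account for at most [z] of each stabiliser. *)
have geP : ((Q + 1) * (z * R) <= 2 * P + 2 * z * (Q + 1))%N.
  have -> : P = (\sum_(A in Omega) #|[set x in N :\: 'Z(N) | x @: A == A]|)%N.
    transitivity (\sum_(x in N :\: 'Z(N)) \sum_(A in Omega) (x @: A == A))%N.
      apply: eq_bigr => x _; rewrite -sum1_card big_mkcond [RHS]big_mkcond.
      by apply: eq_bigr => A _; rewrite inE; case: (A \in Omega); case: (_ == _).
    rewrite exchange_big; apply: eq_bigr => A _.
    rewrite -sum1_card big_mkcond [RHS]big_mkcond.
    by apply: eq_bigr => x _; rewrite inE; case: (x \in _ :\: _); case: (_ == _).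
  have -> : ((Q + 1) * (z * R) = \sum_(A in Omega) #|N|)%N.
    by rewrite sum_nat_const card_spread cardN.
  have -> : (2 * z * (Q + 1) = \sum_(A in Omega) 2 * z)%N.
    by rewrite sum_nat_const card_spread mulnC.
  rewrite big_distrr -big_split /=.
  apply: leq_sum => A OA; apply: leq_trans (stab_ge A OA) _.
  rewrite -mulnDr leq_mul2l /=; apply: leq_trans (leq_card_setU _ _).
  apply: subset_leq_card; apply/subsetP=> x; rewrite in_set => /andP[Nx xA].
  by rewrite in_setU in_set in_setD Nx xA !andbT orNb.
have z_gt0 : (0 < z)%N by apply: cardG_gt0.
have R_ge : (16 <= R)%N.
  by rewrite /R idxN dimVE (@leq_exp2r 4 _ 2) // (@leq_mul2l 2 2).
have Q_ge : (25 <= Q)%N.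
  apply: (@leq_trans (5 ^ m)); last by rewrite leq_exp2r // ltnW.
  by rewrite (@leq_exp2l 5 2).
exact: double_count_arith z_gt0 R_ge Q_ge leP geP.
Qed.

End Spread.

(** As [5 <= q], this makes an eigenspace with at least [q ^ m] vectors large enough for
    [eigenset_in_member]. *)
Lemma square_double_lt_exp5 (m : nat) : (2 <= m -> (2 * m) ^ 2 + 1 < 5 ^ m)%N.
Proof.
move=> m_ge2; rewrite -(subnKC m_ge2); elim: (m - 2)%N => // k.
rewrite addnS [(5 ^ _.+1)%N]expnS mulnS -(ltn_pmul2l (_ : 0 < 5)%N) //.
apply: leq_ltn_trans; rewrite sqrnD mulnDr; have a_gt0 : (0 < 2 * (2 + k))%N by [].
move: (2 * (2 + k))%N a_gt0 => a a_gt0; have : (a <= a ^ 2)%N by rewrite -mulnn leq_pmulr.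
by move: (a ^ 2)%N => b le_ab; rewrite -[(2 ^ 2)%N]/4%N; lia.
Qed.

(** * The case of a normal irreducible subgroup of prime order *)

Section Semilinear.
Variables (F : finFieldType) (V : vectType F) (f : {skew_symmetric V}).
Local Notation fV := (finvect_type V).
Local Notation n := (dim V).
Local Notation q := #|F|.
Variables (G : {group {perm fV}}) (g : {perm fV}) (p : nat).
Hypothesis ndf : nondegenerate f.
Hypothesis n_gt0 : (0 < n)%N.
Hypothesis q1 : q = 1 %[mod 4].
Hypothesis sGS : G \subset Sp f.
Hypothesis Gg : g \in G.
Hypothesis og : #[g]%g = p.
Hypothesis ppd : primitive_divisor p q n.
Hypothesis nsgG : (<[g]> <| G)%g.

Let C := 'C_G(<[g]>)%G.
Let rG := subg_repr (Sp_repr f) sGS.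

Lemma rG_faithful : mx_faithful rG.
Proof. exact: subg_mx_faithful (Sp_repr_faithful f). Qed.

Let sgG : (<[g]> \subset G)%g := normal_sub nsgG.

Lemma cycle_irr : mx_irreducible (subg_repr rG sgG).
Proof.
by apply: (prime_order_mx_irr ppd n_gt0); rewrite ?og //; apply: subg_mx_faithful rG_faithful.
Qed.

Lemma cent_cyclic : cyclic C.
Proof.
exact: (cent_irr_cyclic rG_faithful cycle_irr) (cycle_abelian g).
Qed.

Lemma cent_normal : (C <| G)%g.
Proof.
rewrite /normal subsetIl /= normsI ?normG //.
exact: subset_trans (normal_norm nsgG) (cent_norm _).
Qed.

Lemma centgmx_cent c : c \in C -> centgmx (subg_repr rG sgG) (Sp_repr f c).
Proof.
case/setIP=> Gc /centP cgc; apply/centgmxP=> x gx /=.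
have Gx := subsetP sgG x gx; have cxc : (c * x = x * c)%g by apply: cgc.
have [Sc Sx] : c \in Sp f /\ x \in Sp f by split; apply: (subsetP sGS).
by rewrite -!(repr_mxM (Sp_repr f)) // cxc.
Qed.

(** [(c - a) (c + a) = 0], and [c - a] commutes with the irreducible [<[g]>], so it is 0 or
    invertible. *)
Lemma cent_quadratic c (a : F) : c \in C -> Sp_repr f (c * c)%g = (a ^+ 2)%:M ->
  Sp_repr f c = a%:M \/ Sp_repr f c = (- a)%:M.
Proof.
move=> Cc cc; have /setIP[Gc _] := Cc; have Sc := subsetP sGS c Gc.
have [-> | nz] := eqVneq (Sp_repr f c) a%:M; [by left | right].
have cg := centgmx_cent Cc.
have u : Sp_repr f c - a%:M \in unitmx.
  apply: (mx_Schur cycle_irr); rewrite ?subr_eq0 //; apply/centgmxP=> x gx.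
  by rewrite mulmxBl mulmxBr (centgmxP cg) // scalar_mxC.
apply/eqP; rewrite -subr_eq0 raddfN opprK; apply/eqP.
apply: (can_inj (mulKmx u)); rewrite mulmx0 mulmxDr !mulmxBl -(repr_mxM (Sp_repr f)) // cc.
by rewrite -scalar_mxM -expr2 -scalar_mxC addrA subrK subrr.
Qed.

Lemma cent_involution c : c \in C -> (c * c = 1)%g -> is_scalar_mx (Sp_repr f c).
Proof.
move=> Cc cc1; have : Sp_repr f (c * c)%g = (1 ^+ 2)%:M by rewrite cc1 expr1n repr_mx1.
by case/(cent_quadratic Cc)=> ->; apply: scalar_mx_is_scalar.
Qed.

(** [c * c] is 1 or -1. If it were -1, [c] would be a scalar with square -1, but a scalar isometry
    squares to 1. *)
Lemma cent_order4 c : c \in C -> (c ^+ 4 = 1)%g -> (c * c = 1)%g.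
Proof.
move=> Cc c4; have /setIP[Gc _] := Cc; have Sc := subsetP sGS c Gc.
pose y := (c * c)%g; have Cy : y \in C by rewrite groupM.
have Sy : y \in Sp f by rewrite groupM.
have yy : (y * y = 1)%g by rewrite -c4 /y !expgS expg0 mulg1 !mulgA.
have yy2 : Sp_repr f (y * y)%g = (1 ^+ 2)%:M by rewrite yy expr1n repr_mx1.
case: (cent_quadratic Cy yy2) => y1.
  by apply: (mx_faithful_inj (Sp_repr_faithful f)); rewrite ?group1 // repr_mx1.
have [i i2] := finField_sqrtN1 q1.
have y2 : Sp_repr f (c * c)%g = (i ^+ 2)%:M by rewrite i2.
have nz2 := finField_two_neq0 q1.
have absurd b : b ^+ 2 = -1 -> Sp_repr f c <> b%:M.
  move=> b2 /(Sp_scalar_sqr ndf n_gt0 Sc)/eqP; rewrite b2 eq_sym -subr_eq0 opprK.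
  by rewrite -mulr2n (negbTE nz2).
by case: (cent_quadratic Cc y2) => /absurd; rewrite ?sqrrN => /(_ i2).
Qed.

Lemma cent_2elt c : c \in C -> 2.-elt c -> (c * c = 1)%g.
Proof.
move=> Cc /p_natP[k oc]; case: k => [|[|k]] in oc.
- by move/eqP: oc; rewrite order_eq1 => /eqP ->; rewrite mulg1.
- by rewrite -expg2 -[2%N]/(2 ^ 1)%N -oc expg_order.
have : (c ^+ (2 ^ k) * c ^+ (2 ^ k) = 1)%g.
  apply: cent_order4; first by rewrite groupX.
  by rewrite -expgM -[4%N]/(2 ^ 2)%N -expnD addn2 -oc expg_order.
rewrite -expgD addnn -mul2n -expnS => /eqP; rewrite -order_dvdn oc dvdn_Pexp2l //.
by rewrite ltnn.
Qed.

Variables (m : nat) (Omega : {set {set fV}}).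
Hypothesis dimV : \dim {: V} = (2 * m)%N.
Hypothesis spread : complete_symplectic_spread f m Omega.
Hypothesis trG : [transitive G, on Omega | 'P^*].

Lemma trans_image x A : x \in G -> A \in Omega -> x @: A \in Omega.
Proof.
by move=> Gx OA; rewrite -setact_perm (acts_act _ Gx) //; apply: (atrans_acts trG).
Qed.

Lemma imset_permM (x y : {perm fV}) (A : {set fV}) : (x * y)%g @: A = y @: (x @: A).
Proof. by rewrite -!setact_perm actM. Qed.

Lemma scalar_image x a A : x \in Sp f -> Sp_repr f x = a%:M -> A \in Omega -> x @: A = A.
Proof.
move=> Sx xa OA; apply/eqP; rewrite eqEcard card_imset ?leqnn ?andbT; last exact: perm_inj.
apply/subsetP=> _ /imsetP[v Av ->].
have -> : x v = a *: (v : V) :> V by exact: (@Sp_scalar F V f x a v Sx xa).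
exact: (spread_scale spread).
Qed.

(* C is cyclic, so the stabiliser in C of one member fixes them all; then
   f (v, x v) = 0 for every v, which forces x = x^-1. *)
Lemma cent_stab_square x A : x \in C -> A \in Omega -> x @: A = A -> (x * x = 1)%g.
Proof.
move=> Cx OA xA; have /setIP[Gx _] := Cx; have Sx := subsetP sGS x Gx.
have fixO B : B \in Omega -> x @: B = B.
  move=> OB; have [h Gh ->] := atransP2 trG OA OB.
  have Cxh : (x ^ h)%g \in C by rewrite memJ_norm // (subsetP (normal_norm cent_normal)).
  have /cycleP[k ->] : x \in <[x ^ h]>%g.
    suff /eqP <- : (<[x]> == <[x ^ h]>)%g by apply: cycle_id.
    by rewrite (eq_subG_cyclic cent_cyclic) ?cycle_subG // -!orderE orderJ.
  have xhB : (x ^ h)%g \in 'C[('P^*)%act A h | 'P^*].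
    by apply/astab1P; rewrite -actM -conjgC actM !setact_perm xA.
  have /astab1P := groupX k xhB; by rewrite setact_perm.
have fx0 (v : V) : f v (x v : V) = 0.
  have [B OB Bv] := spread_cover spread v; apply: (spread_isotropic spread OB Bv).
  by rewrite -(fixO B OB) imset_f.
have xlin := Sp_linear Sx.
have xD (u v : V) : x (u + v) = (x u : V) + (x v : V) :> V by rewrite -[u]scale1r xlin !scale1r.
have skew (u v : V) : f u v = - f v u by rewrite hermC expr1 mulN1r.
(* Polarising [f v (x v) = 0] makes [x] self-adjoint; as an isometry its adjoint is also [x^-1]. *)
have polar (u w : V) : f u (x w : V) = f (x u : V) w.
  have := fx0 (u + w); rewrite xD linearDl !linearDr /= !fx0 addr0 add0r.
  by move/eqP; rewrite addr_eq0 => /eqP ->; rewrite -skew.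
apply/permP=> u; rewrite perm1 permM; apply/eqP; rewrite -subr_eq0; apply/eqP.
apply: (nondegenerate_eq0 ndf) => w; rewrite linearBl /=.
have -> : w = x ((x^-1)%g w : V) by rewrite permKV.
by rewrite (Sp_form _ _ Sx) -polar subrr.
Qed.

Lemma cent_stab_scalar x A : x \in C -> A \in Omega -> x @: A = A ->
  forall B, B \in Omega -> x @: B = B.
Proof.
move=> Cx OA xA B OB; have /setIP[Gx _] := Cx.
have /is_scalar_mxP[a xa] := cent_involution Cx (cent_stab_square Cx OA xA).
exact: scalar_image (subsetP sGS x Gx) xa OB.
Qed.

(** Otherwise the even number [q ^ m + 1] would divide the odd index [#|G : S|]. *)
Lemma Sylow2_no_fixed_member (S : {group {perm fV}}) A : 2.-Sylow(G) S -> A \in Omega ->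
  ~~ [forall s in S, s @: A == A].
Proof.
move=> sylS OA; apply/negP=> /forall_inP fixA.
have [sSG _ S2] := and3P sylS.
have sSA : S \subset 'C_G[A | 'P^*].
  rewrite subsetI sSG; apply/subsetP=> s Ss; apply/astab1P; rewrite setact_perm.
  exact/eqP/fixA.
have : (#|Omega| %| #|G : S|%g)%N.
  by rewrite -(atransP trG A OA) card_orbit; apply: indexgS.
rewrite (card_spread spread) => /(dvdn_trans (_ : 2 %| q ^ m + 1)%N); rewrite dvdn2 oddD oddX (odd_eq1_mod4 q1) orbT => /(_ isT).
by move=> dv2; move: S2; rewrite p'natE // dv2.
Qed.

Lemma Sylow2_cent_scalar (S : {group {perm fV}}) s : 2.-Sylow(G) S -> s \in S -> s \in C ->
  is_scalar_mx (Sp_repr f s).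
Proof.
move=> sylS Ss Cs; apply: cent_involution => //; apply: cent_2elt => //.
exact: mem_p_elt (pHall_pgroup sylS) Ss.
Qed.

(** The centraliser of [g] in [S] consists of scalars, so it is central, and the quotient by it
    embeds in the cyclic group [Aut <[g]>]. *)
Lemma Sylow2_abelian (S : {group {perm fV}}) : 2.-Sylow(G) S -> abelian S.
Proof.
move=> sylS; have sSG := pHall_sub sylS; have [p_pr _ _] := ppd.
have nSg : S \subset 'N(<[g]>) := subset_trans sSG (normal_norm nsgG).
apply: (@cyclic_factor_abelian _ ('C_S(<[g]>))%G).
  rewrite subsetI subsetIl; apply/subsetP=> s /setIP[Ss cgs].
  have Gs := subsetP sSG s Ss; have Cs : s \in C by apply/setIP.
  have /is_scalar_mxP[a sa] := Sylow2_cent_scalar sylS Ss Cs.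
  apply/centP=> t St; have Gt := subsetP sSG t St.
  apply: (mx_faithful_inj (Sp_repr_faithful f)); rewrite ?groupM ?(subsetP sGS) //.
  by rewrite !repr_mxM ?(subsetP sGS) // sa scalar_mxC.
have isoS := first_isog_loc (conj_aut_morphism <[g]>) nSg.
rewrite ker_conj_aut in isoS; rewrite (isog_cyclic isoS).
apply: (cyclicS (subset_trans _ (Aut_conj_aut <[g]> S))) => //.
by apply: Aut_prime_cyclic; rewrite -orderE og.
Qed.

(** [S] is not inside [C], as its elements in [C] are scalars and fix all members. [j] is the last
    of the powers [x ^+ (2 ^ i)] outside [C]; it raises [g] to an exponent that squares to 1 modulo
    [p] but is not 1, so it is -1. *)
Lemma Sylow2_inverting (S : {group {perm fV}}) : 2.-Sylow(G) S ->
  exists2 j, j \in S & (j * j)%g \in C /\ (g ^ j = g^-1)%g.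
Proof.
move=> sylS; have sSG := pHall_sub sylS; have [p_pr _ _] := ppd.
have [A OA] : exists A, A \in Omega.
  by apply/set0Pn; rewrite -cards_eq0 (card_spread spread) addn1.
have /subsetPn[x Sx nCx] : ~~ (S \subset C).
  apply: contra (Sylow2_no_fixed_member sylS OA) => sSC; apply/forall_inP=> s Ss.
  have /is_scalar_mxP[a sa] := Sylow2_cent_scalar sylS Ss (subsetP sSC s Ss).
  by rewrite (scalar_image (subsetP sGS s (subsetP sSG s Ss)) sa).
have exi : exists i, (x ^+ (2 ^ i))%g \in C.
  have /p_natP[k ox] : 2.-elt x := mem_p_elt (pHall_pgroup sylS) Sx.
  by exists k; rewrite -ox expg_order group1.
case: (ex_minnP exi) => -[|i] Ci minCi; first by rewrite expn0 expg1 (negbTE nCx) in Ci.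
pose j := (x ^+ (2 ^ i))%g; have Sj : j \in S by rewrite groupX.
have nCj : j \notin C by apply/negP=> /minCi; rewrite ltnn.
have Gj := subsetP sSG j Sj.
have Cjj : (j * j)%g \in C by rewrite -expgD addnn -mul2n -expnS.
exists j => //; split=> //.
have /cycleP[k gj] : (g ^ j)%g \in <[g]>%g.
  by rewrite memJ_norm ?cycle_id // (subsetP (normal_norm nsgG)).
have : (g ^ (j * j) = g)%g.
  have /setIP[_ /centP cg] := Cjj.
  by apply/conjg_fixP/commgP/commute_sym; apply: cg; apply: cycle_id.
have ncj : (g ^ j != g)%g.
  apply: contra nCj => /eqP/conjg_fixP/commgP cgj; rewrite inE Gj /= cent_cycle.
  exact/cent1P/commute_sym.
rewrite conjgM gj conjXg gj -expgM -{2}(expg1 g) => /eqP.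
rewrite eq_expg_mod_order og; case: k gj => [|k] gj; first by rewrite mod0n modn_small ?prime_gt1.
rewrite eqn_mod_dvd // -[X in (_ - X)%N](mul1n 1%N) -[X in (X * _ - _)%N]/(k.+1)%N mulnn -[X in (_ - X)%N](exp1n 2) subn_sqr subn1 addn1 /=.
rewrite Euclid_dvdM // => /orP[pk | pk].
  case/eqP: ncj; apply/eqP; rewrite gj -{2}(expg1 g) eq_expg_mod_order og.
  by rewrite eqn_mod_dvd // subn1.
by apply/eqP; rewrite eq_sym eq_invg_mul -expgS -order_dvdn og.
Qed.

(** [c] is a linear combination of elements [x] of [<[g]>], so [c ^ j] is the same combination of
    the [x^-1]. These are the adjoints of the [x], so [c ^ j] is the adjoint of [c], which is
    [c^-1]. *)
Lemma inverting_cent j c : j \in G -> (g ^ j = g^-1)%g -> c \in C -> (c ^ j = c^-1)%g.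
Proof.
move=> Gj gj Cc; have /setIP[Gc _] := Cc.
have [Sj Sc] : j \in Sp f /\ c \in Sp f by split; apply: (subsetP sGS).
have sgS : {in <[g]>%g, forall x, x \in Sp f}.
  by move=> x /(subsetP sgG)/(subsetP sGS).
have := irr_abelian_cent_envelop cycle_irr (cycle_abelian g) (centgmx_cent Cc).
case/envelop_mxP=> a cE; have cv (v : V) := Sp_sum (y := id) v Sc sgS cE.
have xj x : x \in <[g]>%g -> (x ^ j = x^-1)%g.
  by case/cycleP=> k ->; rewrite conjXg gj expgVn.
have cjE : Sp_repr f (c ^ j)%g = \sum_(x in <[g]>%g) a x *: Sp_repr f (x^-1)%g.
  rewrite conjgE !repr_mxM ?groupM ?groupV // [Sp_repr f c]cE mulmx_suml mulmx_sumr.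
  apply: eq_bigr => x gx; have Sx := sgS x gx.
  by rewrite -scalemxAl -scalemxAr -(xj x gx) conjgE !repr_mxM ?groupM ?groupV.
have sgSV : {in <[g]>%g, forall x, x^-1%g \in Sp f} by move=> x /sgS; rewrite groupV.
have Scj : (c ^ j)%g \in Sp f by rewrite groupJ.
have cjv (v : V) := Sp_sum (y := fun x => x^-1%g) v Scj sgSV cjE.
apply/permP=> w; apply/eqP; rewrite -subr_eq0; apply/eqP.
apply: (nondegenerate_eq0 ndf) => v; rewrite linearBl /=.
have formV x : x \in Sp f -> f (x^-1%g w : V) v = f w (x v : V).
  by move=> Sx; rewrite -(Sp_form _ _ Sx) permKV.
rewrite (formV c Sc) cjv cv linear_sumlz linear_sumr -sumrB big1 // => x gx.
by rewrite linearZl_LR linearZr_LR /= (formV x (sgS x gx)) subrr.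
Qed.

(** Conjugates of [g] lie in [<[g]>], so they commute and have invertible differences by Schur's
    lemma. *)
Lemma conj_class_card : (#|g ^: G| <= n)%N.
Proof.
apply: (conj_commute_card n_gt0 rG_faithful Gg (subxx _)).
  have sg : g ^: G \subset <[g]>%g by rewrite class_sub_norm ?cycle_id // normal_norm.
  by move=> x y /(subsetP sg) gx /(subsetP sg) gy; apply: (centsP (cycle_abelian g)).
move=> x y Gx Gy ne_xy.
have sg : g ^: G \subset <[g]>%g by rewrite class_sub_norm ?cycle_id // normal_norm.
have cC z : z \in g ^: G -> z \in C.
  move=> /(subsetP sg) gz; apply/setIP; split; first exact: (subsetP sgG).
  by apply: (subsetP _ z gz); apply: cycle_abelian.
have [/centgmx_cent cx /centgmx_cent cy] := (cC x Gx, cC y Gy).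
apply: (mx_Schur cycle_irr).
  by apply/centgmxP=> z gz; rewrite mulmxBl mulmxBr (centgmxP cx) // (centgmxP cy).
rewrite subr_eq0 (inj_in_eq (mx_faithful_inj rG_faithful)) //.
  by case/setIP: (cC x Gx).
by case/setIP: (cC y Gy).
Qed.

(** With a fixed base member [A0], sending [B = h @: A0] to [g ^ h] maps the fixed members
    injectively to conjugates of [g]. *)
Lemma inverting_fixed_members j : j \in G -> (g ^ j = g^-1)%g ->
  (#|fixed_members Omega j| <= n)%N.
Proof.
move=> Gj gj; apply: leq_trans conj_class_card.
have [->|[A0]] := set_0Vmem (fixed_members Omega j); first by rewrite cards0.
rewrite inE => /andP[OA0 /eqP jA0].
have hP B : exists h, (B \in fixed_members Omega j) ==> (h \in G) && (B == h @: A0).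
  have [| _] := boolP (B \in _); last by exists 1%g.
  rewrite inE => /andP[OB _]; have [h Gh ->] := atransP2 trG OA0 OB.
  by exists h; rewrite Gh setact_perm eqxx.
pose h B := xchoose (hP B).
have hE B : B \in fixed_members Omega j -> h B \in G /\ B = h B @: A0.
  by move=> fB; have /implyP/(_ fB)/andP[? /eqP] := xchooseP (hP B).
rewrite -(card_in_imset (f := fun B => (g ^ h B)%g)); last first.
  move=> B B' fB fB' eq_gh; have [[Gh BE] [Gh' BE']] := (hE B fB, hE B' fB').
  move: (fB) (fB'); rewrite !inE => /andP[OB /eqP jB] /andP[OB' /eqP jB'].
  (* [t] centralises [g] and maps [B] to [B']. As [j] fixes both and inverts [t], [t * t] fixes [B];
     this forces [t] to be a scalar, so [B' = B]. *)
  pose t := ((h B)^-1 * h B')%g; have Gt : t \in G by rewrite groupM ?groupV.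
  have B't : B' = t @: B by rewrite BE BE' -imset_permM /t mulKVg.
  have Ct : t \in C.
    rewrite inE Gt /= -(normsP (normal_norm nsgG) _ Gh) -cycleJ cent_cycle.
    apply/cent1P/commute_sym/commgP/conjg_fixP.
    by rewrite -conjgM /t mulKVg -eq_gh.
  have ttB : (t * t)%g @: B = B.
    have tj : t @: B = t^-1%g @: B.
      have := jB'; rewrite B't -imset_permM conjgC imset_permM jB => <-.
      by rewrite (inverting_cent Gj gj Ct).
    by rewrite imset_permM {1}tj -imset_permM mulVg -setact_perm act1.
  have tt4 := cent_stab_square (groupM Ct Ct) OB ttB.
  have tt : (t * t = 1)%g by apply: cent_order4 => //; rewrite -tt4 !expgS expg0 mulg1 !mulgA.
  have /is_scalar_mxP[a ta] := cent_involution Ct tt.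
  by rewrite B't (scalar_image (subsetP sGS t Gt) ta OB).
apply: subset_leq_card; apply/subsetP=> _ /imsetP[B fB ->].
by apply: imset_f; have [] := hE B fB.
Qed.

(** Every nonzero vector of [E] lies in a fixed member. If none of these contains [E], each meets
    [E] in at most [#|T| - 1] vectors, so [E] is too small. *)
Lemma eigenset_in_member (j : {perm fV}) (a : F) :
    j \in G -> j \in Sp f -> a != 0 -> (#|fixed_members Omega j| ^ 2 + 1 < #|eigenset j a|)%N ->
  exists2 A, A \in Omega & eigenset j a \subset A.
Proof.
move=> Gj Sj nza; set E := eigenset j a; set T := fixed_members Omega j => lt_E.
have sTO : T \subset Omega by apply/subsetP=> A; rewrite inE => /andP[].
have coverE v : (v : fV) \in E -> v != 0 -> exists2 A, A \in T & v \in A.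
  move=> Ev nzv; have [A OA Av] := spread_cover spread v; exists A => //.
  rewrite inE OA; apply/eqP; apply: (eigenset_fix spread nza) Ev nzv Av => //.
  exact: trans_image.
have [/existsP[A /andP[TA sEA]] | noA] := boolP [exists A, (A \in T) && (E \subset A)].
  by exists A => //; apply: (subsetP sTO).
suff le_E : (#|E :\ 0%R| <= #|T| * #|T|.-1)%N.
  have E0 : (0 : fV) \in E by exact: (eigenset_mem0 _ Sj).
  move: lt_E; rewrite (cardsD1 (0 : fV) E) E0 addnC ltn_add2l => lt_E.
  have := leq_trans lt_E le_E.
  by rewrite -mulnn ltn_mul2l [(_ < _.-1)%N]ltnNge leq_pred andbF.
(* For [u] in [E] outside [A], the vectors [u + b] with [b] in [A :&: E] lie in members of [T] other
   than [A], and in different ones: a common member would share a nonzero [b - c] with [A]. *)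
have le_AE A : A \in T -> (#|A :&: E| <= #|T|.-1)%N.
  move=> TA; have OA := subsetP sTO A TA.
  have /subsetPn[u Eu nAu] : ~~ (E \subset A).
    by apply: contra noA => sEA; apply/existsP; exists A; rewrite TA.
  have hP (b : fV) : exists B, (b \in A :&: E) ==>
      (B \in T :\ A) && (((u : V) + b : fV) \in B).
    have [/setIP[Ab Eb] | _] := boolP (b \in _); last by exists A.
    have Eub : ((u : V) + b : fV) \in E.
      by rewrite -[u : V]scale1r; apply: (eigenset_linear _ Sj).
    have nAub : ((u : V) + b : fV) \notin A.
      apply: contra nAu => Aub; rewrite -[u](addrK (b : V)) addrC -scaleN1r.
      exact: (spread_linear spread).
    have nz : (u : V) + b != 0 by apply: contraNneq nAub => ->; apply: (spread_mem0 spread).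
    have [B TB Bub] := coverE _ Eub nz; exists B; rewrite in_setD1 TB Bub !andbT /=.
    by apply: contraNneq nAub => <-.
  pose h b := xchoose (hP b).
  have hE b : b \in A :&: E -> h b \in T :\ A /\ ((u : V) + b : fV) \in h b.
    by move=> Ab; have /implyP/(_ Ab)/andP := xchooseP (hP b).
  have -> : #|T|.-1 = #|T :\ A| by rewrite (cardsD1 A T) TA.
  rewrite -(card_in_imset (f := h)).
    by apply: subset_leq_card; apply/subsetP=> _ /imsetP[b Ab ->]; have [] := hE b Ab.
  move=> b c Ab Ac eq_h; have [Tb hb] := hE b Ab; have [_ hc] := hE c Ac.
  apply/eqP; rewrite -subr_eq0; apply: contraT => nz.
  have /setD1P[neqA hbT] := Tb; have Ohb := subsetP sTO _ hbT.
  case/eqP: neqA; apply: (spread_eq spread Ohb OA nz).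
    have -> : (b : V) - c = -1 *: ((u : V) + c) + ((u : V) + b).
      by rewrite scaleN1r opprD addrACA addNr add0r addrC.
    by apply: (spread_linear spread) => //; rewrite eq_h.
  have [[Ab' _] [Ac' _]] := (setIP Ab, setIP Ac).
  by rewrite addrC -scaleN1r; apply: (spread_linear spread).
rewrite -sum_nat_const -sum1_card.
apply: (@leq_trans (\sum_(v in E :\ 0%R) \sum_(A in T) (v \in A))%N).
  apply: leq_sum => v /setD1P[nzv Ev]; have [A TA Av] := coverE _ Ev nzv.
  by rewrite (bigD1 A) //= Av.
rewrite exchange_big; apply: leq_sum => A TA; apply: leq_trans (le_AE A TA).
rewrite -big_mkcondr sum1_card; apply: subset_leq_card.
by apply/subsetP=> v /andP[/setD1P[_ Ev] Av]; rewrite inE Av.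
Qed.

(** A large eigenspace of [j] lies in a member [A] and is preserved by the abelian group [S]. For a
    nonzero [v] in it, [s v] lies in both [A] and [s @: A], so [S] fixes [A]. *)
Lemma normal_cycle_not_transitive : (2 <= m)%N -> False.
Proof.
move=> m_ge2; have [S sylS] := Sylow_exists 2 G; have sSG := pHall_sub sylS.
have [j Sj [Cjj gj]] := Sylow2_inverting sylS; have Gj := subsetP sSG j Sj.
have Spj := subsetP sGS j Gj.
have /is_scalar_mxP[a jja] := Sylow2_cent_scalar sylS (groupM Sj Sj) Cjj.
have [c nzc jjc] := square_scalar_root ndf n_gt0 q1 Spj erefl jja.
have [d nzd le_d] : exists2 d, d != 0 & (q ^ m <= #|eigenset j d|)%N.
  have := card_eigenset_opp dimV (finField_two_neq0 q1) nzc Spj jjc.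
  have [le_c | gt_c] := leqP (q ^ m) #|eigenset j c|; first by exists c.
  rewrite mul2n -addnn expnD => eq_card; exists (- c); rewrite ?oppr_eq0 //.
  rewrite leqNgt; apply/negP=> gt_c'; have := ltn_mul gt_c gt_c'.
  by rewrite eq_card ltnn.
have q_ge5 := card_ge5_eq1_mod4 q1.
have lt_E : (#|fixed_members Omega j| ^ 2 + 1 < #|eigenset j d|)%N.
  apply: leq_trans le_d; apply: (@leq_ltn_trans (n ^ 2 + 1)).
    by rewrite leq_add2r leq_exp2r // inverting_fixed_members.
  rewrite -dimvf dimV; apply: (@leq_trans (5 ^ m)); last by rewrite leq_exp2r // ltnW.
  exact: square_double_lt_exp5.
have [A OA sEA] := eigenset_in_member Gj Spj nzd lt_E.
case/negP: (Sylow2_no_fixed_member sylS OA); apply/forall_inP=> s Ss.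
have Gs := subsetP sSG s Ss.
have [v Ev nzv] : exists2 v : fV, v \in eigenset j d & v != 0.
  have lt1 : (1 < #|eigenset j d|)%N := leq_ltn_trans (leq_addl _ _) lt_E.
  have /card_gt0P[v] : (0 < #|eigenset j d :\ 0%R|)%N.
    by move: lt1; rewrite (cardsD1 (0 : fV)); case: (_ \in _) => // /ltnW.
  by case/setD1P=> nzv Ev; exists v.
have Esv : s v \in eigenset j d.
  have /Sp_linear slin := subsetP sGS s Gs.
  have cjs : (s * j = j * s)%g by apply: (centsP (Sylow2_abelian sylS)).
  rewrite inE -permM cjs permM; rewrite inE in Ev; rewrite (eqP Ev); apply/eqP.
  have s0 := Sp_linear0 (subsetP sGS s Gs).
  by have := slin d v 0; rewrite !addr0 s0 addr0.
apply/eqP; apply: (@spread_eq _ _ _ _ _ spread _ _ (s v)) => //.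
- exact: trans_image.
- apply: contraNneq nzv => sv0; apply/eqP; apply: (@perm_inj _ s); rewrite sv0.
  by rewrite (Sp_linear0 (subsetP sGS s Gs)).
- by apply: imset_f; apply: (subsetP sEA).
exact: (subsetP sEA).
Qed.

End Semilinear.

(** * Intransitivity of solvable groups on complete symplectic spreads *)

Local Open Scope nat_scope.
Unset Implicit Arguments.

Theorem theorem3p5 (F : finFieldType) (q m : nat) (V : vectType F)
    (f : {skew_symmetric V}%R) (G : {group {perm finvect_type V}}) :
  #|F| = q -> q = 1 %[mod 4] ->
  2 <= m -> \dim {: V} = 2 * m ->
  alternating f -> nondegenerate f ->
  G \subset Sp f -> solvable G ->
  forall Omega : {set {set finvect_type V}},
    complete_symplectic_spread f m Omega ->
    ~ [transitive G, on Omega | 'P^*].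
Proof.
move=> <- q1 m_ge2 dimV _ ndf sGS solG Omega spread trG.
have dimVE : dim V = 2 * m by rewrite -dimV dimvf.
have n_gt2 : 2 < dim V by rewrite dimVE (@leq_trans 4) // (@leq_mul2l 2 2).
have n_gt0 : 0 < dim V by apply: leq_trans n_gt2.
have [p ppd] := primitive_prime_divisor (ltnW (card_ge5_eq1_mod4 q1)) n_gt2.
have [p_pr p_qn p_prim] := ppd.
(* [p] divides [(q ^ m - 1) * (q ^ m + 1)] but, being primitive, not the first factor; so it divides
   [#|Omega|]. *)
have pG : p %| #|G|.
  apply: dvdn_trans (atrans_dvd trG); rewrite (card_spread spread).
  move: p_qn; rewrite dimVE mulnC expnM -subn1 -[X in _ - X](exp1n 2) subn_sqr subn1.
  rewrite Euclid_dvdM // (negbTE (p_prim m _)) //.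
  by rewrite (ltnW m_ge2) dimVE -[X in X < _]mul1n ltn_pmul2r // ltnW.
have [g Gg og] := Cauchy p_pr pG.
pose rG := subg_repr (Sp_repr f) sGS.
have fG : mx_faithful rG by apply: subg_mx_faithful (Sp_repr_faithful f).
have [nsgG | [N [nsNG abN idxN scZ]]] := solvable_irr_dichotomy fG solG Gg og ppd (ltnW n_gt2).
  exact: (normal_cycle_not_transitive ndf n_gt0 q1 sGS Gg og ppd nsgG dimV spread trG m_ge2).
exact: (spread_no_extraspecial_normal dimV spread ndf q1 m_ge2 sGS trG nsNG abN idxN scZ).
Qed.
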